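(* Let $\Bbbk$ be a field, $R=\Bbbk[x_1,\ldots,x_n]$ with its standard $\mathbb{Z}^n$-grading, and let $N\subsetneq R$ be an ideal generated by monomials, with LCM-lattice $L_N$. Let $\deg:L_N\to\mathbb{N}^n$ be the map of posets sending a monomial $m=x_1^{\alpha_1}\cdots x_n^{\alpha_n}\in L_N$ to $\deg(m)=(\alpha_1,\ldots,\alpha_n)$, and let $\mathbb{F}(\deg)$ be the associated sequence of multigraded free $R$-modules and multigraded homomorphisms. Then $N$ is lattice-linear if and only if $\mathbb{F}(\deg)$ is a minimal multigraded free resolution of $R/N$.
   Context: **LCM-lattice.** $L_N$ is the set of least common multiples of all subsets of the set of minimal monomial generators of $N$ (with $1$ the lcm of the empty set), ordered by divisibility. Its least element is $\hat 0=1$, and its atoms are the minimal monomial generators of $N$. Monomials are identified with their degrees in $\mathbb{N}^n$, so $L_N\subset\mathbb{N}^n$. If $\mathbb{F}$ is the minimal multigraded free resolution of $R/N$, then the degrees of the elements of any multihomogeneous basis of any $F_i$ lie in $L_N$. **Lattice-linear.** Let $\mathbb{F}$ be a minimal multigraded free resolution of $R/N$ with differential $\partial^{\mathbb{F}}$. $N$ is *lattice-linear* if multihomogeneous bases $B_k$ of $F_k$ can be fixed for all $k$ so that for any $i\ge 1$ and any $v\in B_i$, writing $\partial^{\mathbb{F}}(v)=\sum_{v'\in B_{i-1}}m_{v,v'}\cdot v'$, one has: if $m_{v,v'}\neq 0$ then $\deg(v')\lessdot\deg(v)$ in $L_N$. (Here $\lambda\lessdot\alpha$ means that $\alpha$ covers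 $\lambda$.) **The sequence $C_\bullet(P)$.** Let $P$ be a finite poset with least element $\hat 0$ and set of atoms $S=\{a:\hat 0\lessdot a\}$. Simplicial complexes may be void (no faces, all reduced homology $0$) or equal to $\{\emptyset\}$ (reduced homology $\Bbbk$ in degree $-1$ only); $\widetilde H$ is reduced simplicial homology. For $\alpha\in P$ let $\mathbf{D}_\alpha$ be the simplicial complex of all chains (including the empty one) in $(\hat 0,\alpha]$, and let $\Delta_\alpha=\bigcup_{\lambda\lessdot\alpha}\mathbf{D}_\lambda$; for $\alpha\ne\hat 0$ this is the order complex of the open interval $(\hat 0,\alpha)$. For $\lambda\lessdot\alpha$ let $\Delta_{\alpha,\lambda}=\mathbf{D}_\lambda\cap\bigcup_{\beta\lessdot\alpha,\ \beta\neq\lambda}\mathbf{D}_\beta\subset\Delta_\lambda$. Set $C_0=\widetilde H_{-1}(\{\emptyset\},\Bbbk)\cong\Bbbk$. For $i\ge1$ and $\alpha\ne\hat 0$ set $C_{i,\alpha}=\widetilde H_{i-2}(\Delta_\alpha,\Bbbk)$ and $C_i=\bigoplus_{\alpha\in P\setminus\{\hat 0\}}C_{i,\alpha}$. Thus $C_{1,\alpha}=\widetilde H_{-1}(\{\emptyset\},\Bbbk)$ if $\alpha\in S$, and $C_{1,\alpha}=0$ otherwise. The map $\varphi_1:C_1\to C_0$ is the identity of $\widetilde H_{-1}(\{\emptyset\},\Bbbk)$ on each $C_{1,\alpha}$, $\alpha\in S$. For $i\ge2$, $\varphi_i:C_i\to C_{i-1}$ is given by $\varphi_i|_{C_{i,\alpha}}=\sum_{\lambda\lessdot\alpha}\varphi_i^{\alpha,\lambda}$,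 where $\varphi_i^{\alpha,\lambda}:C_{i,\alpha}\to C_{i-1,\lambda}$ (zero for $\lambda=\hat 0$) is the composition $$\widetilde H_{i-2}(\Delta_\alpha,\Bbbk)\xrightarrow{\ \delta\ }\widetilde H_{i-3}(\Delta_{\alpha,\lambda},\Bbbk)\xrightarrow{\ \iota\ }\widetilde H_{i-3}(\Delta_\lambda,\Bbbk).$$ Here $\delta$ is the Mayer–Vietoris connecting homomorphism for $\Delta_\alpha=\mathbf{D}_\lambda\cup\bigcup_{\beta\lessdot\alpha,\beta\ne\lambda}\mathbf{D}_\beta$ (it sends $[c]$ to $[d(c')]$, where $c=c'+c''$ with $c'$ supported on $\mathbf{D}_\lambda$ and $c''$ supported on the other part, and $d$ is the simplicial boundary), and $\iota$ is induced by inclusion. **The sequence $\mathbb{F}(\eta)$.** For a map of posets $\eta:P\to\mathbb{N}^n$, $\mathbb{F}(\eta)$ is the sequence $\cdots\to F_i\xrightarrow{\partial_i}F_{i-1}\to\cdots\to F_1\xrightarrow{\partial_1}F_0$ with: - $F_0=R\otimes_\Bbbk C_0$, where $\deg(x^\alpha\otimes v)=\alpha$; - for $i\ge1$, $F_i=\bigoplus_{\hat 0\ne\lambda\in P}F_{i,\lambda}$, $F_{i,\lambda}=R\otimes_\Bbbk C_{i,\lambda}$, where $\deg(x^\alpha\otimes v)=\alpha+\eta(\lambda)$ for $v\in C_{i,\lambda}$; - $\partial_1|_{F_{1,\lambda}}=x^{\eta(\lambda)}\otimes\varphi_1|_{C_{1,\lambda}}$; - for $i\ge2$, $\partial_i|_{F_{i,\alpha}}=\sum_{\lambda\lessdot\alpha}x^{\eta(\alpha)-\eta(\lambda)}\otimes\varphi_i^{\alpha,\lambda}$.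 In the claim $P=L_N$ and $\eta=\deg$. ''$\mathbb{F}(\deg)$ is a minimal free resolution of $R/N$'' means that it is a complex, exact in positive homological degrees, with $\operatorname{coker}\partial_1=R/N$, and with $\partial_i(F_i)\subset(x_1,\ldots,x_n)F_{i-1}$ for all $i\ge 1$. *)

(* Defs.v *)
From Stdlib Require Import ClassicalEpsilon.
From HB Require Import structures.
From mathcomp Require Import all_boot all_order all_algebra.
From mathcomp Require Import mpoly.

Set Implicit Arguments.
Unset Strict Implicit.
Unset Printing Implicit Defensive.

Import Order.TTheory GRing.Theory.

Local Open Scope ring_scope.

Section DirectSum.
Variables (R : nzRingType) (I : finType) (V : I -> lmodType R).

Definition dsum : Type := {dffun forall i, V i}.
HB.instance Definition _ := Choice.on dsum.

Implicit Types u v w : dsum.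

Definition dsum0 : dsum := [ffun i => 0 : V i].
Definition dsum_opp u : dsum := [ffun i => - u i].
Definition dsum_add u v : dsum := [ffun i => u i + v i].
Definition dsum_scale (a : R) u : dsum := [ffun i => a *: u i].

Fact dsum_addA : associative dsum_add.
Proof. by move=> u v w; apply/ffunP=> i; rewrite !ffunE addrA. Qed.
Fact dsum_addC : commutative dsum_add.
Proof. by move=> u v; apply/ffunP=> i; rewrite !ffunE addrC. Qed.
Fact dsum_add0 : left_id dsum0 dsum_add.
Proof. by move=> u; apply/ffunP=> i; rewrite !ffunE add0r. Qed.
Fact dsum_addN : left_inverse dsum0 dsum_opp dsum_add.
Proof. by move=> u; apply/ffunP=> i; rewrite !ffunE addNr. Qed.
HB.instance Definition _ :=
  GRing.isZmodule.Build dsum dsum_addA dsum_addC dsum_add0 dsum_addN.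

Fact dsum_scaleA a b u : dsum_scale a (dsum_scale b u) = dsum_scale (a * b) u.
Proof. by apply/ffunP=> i; rewrite !ffunE scalerA. Qed.
Fact dsum_scale1 : left_id 1 dsum_scale.
Proof. by move=> u; apply/ffunP=> i; rewrite !ffunE scale1r. Qed.
Fact dsum_scaleDr : right_distributive dsum_scale +%R.
Proof. by move=> a u v; apply/ffunP=> i; rewrite !ffunE scalerDr. Qed.
Fact dsum_scaleDl u : {morph dsum_scale^~ u : a b / a + b}.
Proof. by move=> a b; apply/ffunP=> i; rewrite !ffunE scalerDl. Qed.
HB.instance Definition _ :=
  GRing.Zmodule_isLmodule.Build R dsum
    dsum_scaleA dsum_scale1 dsum_scaleDr dsum_scaleDl.

Lemma dsumDE u v i : (u + v) i = u i + v i. Proof. exact: ffunE. Qed.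
Lemma dsumZE a u i : (a *: u) i = a *: u i. Proof. exact: ffunE. Qed.

End DirectSum.

(* A simplicial complex on the vertex set P is given by its set of faces, so
   set0 is the void complex and [set set0] is the complex {emptyset}.  All
   complexes used below have chains of P as faces, and a face
   a_0 < ... < a_q is oriented by the order of P.
   Faces are graded by their cardinality: [hom K j] is the reduced homology
   of K in dimension j - 1. *)

Section Homology.
Variables (k : fieldType) (disp : Order.disp_t) (P : finPOrderType disp).

Definition chainsp : vectType k := {ffun {set P} -> k^o}.

Definition face (s : {set P}) : chainsp := [ffun t => (t == s)%:R].

Definition bd_face (s : {set P}) : chainsp :=
  \sum_(a in s) (-1) ^+ #|[set b in s | (b < a)%O]| *: face (s :\ a).

Definition bd_fun (c : chainsp) : chainsp :=
  \sum_(s : {set P}) (c s : k) *: bd_face s.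

Fact bd_fun_linear : linear bd_fun.
Proof.
move=> a c c'; rewrite /bd_fun scaler_sumr -big_split; apply: eq_bigr => s _.
by rewrite !ffunE scalerDl scalerA.
Qed.
HB.instance Definition _ :=
  GRing.isLinear.Build k chainsp chainsp *:%R bd_fun bd_fun_linear.

Definition bd : 'End(chainsp) := linfun bd_fun.

Definition restr_fun (L : {set {set P}}) (c : chainsp) : chainsp :=
  [ffun s => if s \in L then c s else 0].

Fact restr_fun_linear L : linear (restr_fun L).
Proof.
by move=> a c c'; apply/ffunP => s; rewrite !ffunE; case: ifP; rewrite ?scaler0 ?addr0.
Qed.
HB.instance Definition _ L :=
  GRing.isLinear.Build k chainsp chainsp *:%R (restr_fun L) (restr_fun_linear L).

Definition restr L : 'End(chainsp) := linfun (restr_fun L).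

Definition chains (K : {set {set P}}) (j : nat) : {vspace chainsp} :=
  <<[seq face s | s <- enum [set s in K | #|s| == j]]>>%VS.
Definition cycles K j : {vspace chainsp} := (chains K j :&: lker bd)%VS.
Definition boundaries K j : {vspace chainsp} := (bd @: chains K j.+1)%VS.

(* The quotient cycles / boundaries is realized on the complement
   [cycles :\: boundaries] of the boundaries in the space of cycles; [hclass]
   is the quotient map (see [hclass_eq0] and [hclassK]). *)
Definition hom K j : vectType k := subvs_of (cycles K j :\: boundaries K j).

Definition hrep K j : 'Hom(hom K j, chainsp) := linfun vsval.
Definition hclass K j : 'Hom(chainsp, hom K j) :=
  (linfun (vsproj _) \o addv_pi1 (cycles K j) (boundaries K j))%VF.

Lemma hrep_cycle K j x : hrep K j x \in cycles K j.
Proof. by rewrite lfunE; apply: (subvP (diffvSl _ _)); apply: subvsP. Qed.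

Lemma hclassK K j x : hclass K j (hrep K j x) = x.
Proof.
rewrite !lfunE /= lfunE /= /addv_pi1 daddv_pi_id ?vsvalK //.
  exact: capv_diff.
exact: subvsP.
Qed.

Lemma hclass_eq0 K j z :
  z \in cycles K j -> (hclass K j z == 0) = (z \in boundaries K j).
Proof.
move=> Zz; have Uz : z \in (cycles K j + boundaries K j)%VS.
  by apply: (subvP (addvSl _ _)).
have M : addv_pi1 (cycles K j) (boundaries K j) z
           \in (cycles K j :\: boundaries K j)%VS by apply: memv_pi.
have E := addv_pi1_pi2 Uz; apply/idP/idP => [/eqP h | Bz].
  rewrite -E -[X in X + _](vsprojK M).
  by move: h; rewrite !lfunE /= lfunE /= => ->; rewrite linear0 add0r memv_pi2.
move: E; rewrite (addv_pi2_id _ Bz) => /(canRL (addrK _)); rewrite subrr => E.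
by rewrite !lfunE /= lfunE /= E linear0.
Qed.

Lemma mem_chains (K : {set {set P}}) j (c : chainsp) :
  reflect (forall s, c s != 0 -> s \in K /\ #|s| = j) (c \in chains K j).
Proof.
apply: (iffP idP) => [|h].
  rewrite /chains; set X := [seq face s | s <- _] => cX s.
  rewrite (@coord_span _ _ _ (in_tuple X) c cX) sum_ffunE => nz.
  have [i] : exists i : 'I_(size X), (coord (in_tuple X) i c *: X`_i) s != 0.
    apply/existsP; apply: contraNT nz; rewrite negb_exists => /forallP z.
    by rewrite big1 // => i _; have := z i; rewrite negbK => /eqP.
  have := ltn_ord i.
  move: (coord _ _ _) => a; move: (nat_of_ord i) => {}i lt_i.
  have : X`_i \in X by apply: mem_nth.
  case/mapP=> t; rewrite mem_enum inE => /andP[Kt /eqP jt] ->.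
  have [->|/negPf st] := eqVneq s t; first by [].
  by rewrite !ffunE st scaler0 eqxx.
have -> : c = \sum_(s in [set s in K | #|s| == j]) (c s : k) *: face s.
  apply/ffunP=> t; rewrite sum_ffunE.
  under eq_bigr => s _ do rewrite !ffunE /=.
  have [tK|tK] := boolP (t \in [set s in K | #|s| == j]).
    rewrite (bigD1 t) //= eqxx big1 ?addr0; first by rewrite /GRing.scale /= mulr1.
    by move=> s /andP[_ /negPf st]; rewrite eq_sym st scaler0.
  rewrite big1 => [|s sK].
    apply/eqP; apply: contraNT tK => /h[tK tj]; rewrite inE tK; exact/eqP.
  case: eqP => [e|_]; last by rewrite scaler0.
  by rewrite e sK in tK.
apply: memv_suml => s sK; apply/memvZ/memv_span/map_f.
by rewrite mem_enum.
Qed.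

End Homology.

Section PosetComplex.
Variables (k : fieldType) (disp : Order.disp_t) (P : finBPOrderType disp).
Implicit Types a b l : P.

Definition covers l a : bool :=
  (l < a)%O && [forall b : P, ~~ ((l < b)%O && (b < a)%O)].

Definition Dcx a : {set {set P}} :=
  [set s : {set P} | [forall x in s, ((\bot < x) && (x <= a))%O]
                     && [forall x in s, forall y in s, (x >=< y)%O]].

Definition Delta a : {set {set P}} := \bigcup_(l | covers l a) Dcx l.

Definition Delta2 a l : {set {set P}} :=
  Dcx l :&: \bigcup_(b | covers b a && (b != l)) Dcx b.

Definition C0 : vectType k := hom k [set set0 : {set P}] 0.

(* [C j a] is C_{j+1,a}. *)
Definition C (j : nat) a : vectType k := hom k (Delta a) j.

(* [connecting j a l] is the connecting homomorphism on C_{j+2,a}: the part of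
   a cycle supported on D_l is taken to be its restriction to the faces of D_l,
   so that the rest is supported on the other D_b covering Delta a. *)
Definition connecting j a l : 'Hom(C j.+1 a, hom k (Delta2 a l) j) :=
  (hclass k (Delta2 a l) j
     \o (bd k P \o (restr k (Dcx l) \o hrep k (Delta a) j.+1)))%VF.

Definition inclusion j a l : 'Hom(hom k (Delta2 a l) j, C j l) :=
  (hclass k (Delta l) j \o hrep k (Delta2 a l) j)%VF.

(* For an atom a, Delta a = [set set0], so that the first map is the
   identity of the homology of [set set0]. *)
Definition phi1 a : 'Hom(C 0 a, C0) :=
  if covers \bot%O a then (hclass k [set set0] 0 \o hrep k (Delta a) 0)%VF else 0.

(* [phi j a l] is phi_{j+2}^{a,l}. *)
Definition phi j a l : 'Hom(C j.+1 a, C j l) :=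
  (inclusion j a l \o connecting j a l)%VF.

End PosetComplex.

Section BaseChange.
Variables (k : fieldType) (n : nat).
Local Notation R := {mpoly k[n]}.

(* R (x) V as the free module of coordinate vectors on the basis 1 (x) e_i,
   for the basis e = vbasis {:V} of V; [tens p v] is p (x) v. *)
Definition bchange (V : vectType k) : lmodType R := 'rV[R]_(\dim {:V}).

Definition tens (V : vectType k) (p : R) (v : V) : bchange V :=
  p *: map_mx (@mpolyC n k) (passmx.rVof (vbasis {:V}) v).

(* the map x^m (x) f *)
Definition bchange_map (V W : vectType k) (m : 'X_{1..n}) (f : 'Hom(V, W))
    (u : bchange V) : bchange W :=
  'X_[m] *: (u *m map_mx (@mpolyC n k) (passmx.mxof (vbasis {:V}) (vbasis {:W}) f)).

Fact bchange_map_linear V W m f : linear (@bchange_map V W m f).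
Proof.
move=> a u v; rewrite /bchange_map mulmxDl -scalemxAl scalerDr.
by rewrite !scalerA mulrC.
Qed.
HB.instance Definition _ V W m f :=
  GRing.isLinear.Build R (bchange V) (bchange W) *:%R (@bchange_map V W m f)
    (@bchange_map_linear V W m f).

Lemma bchange_map_tens (V W : vectType k) m (f : 'Hom(V, W)) p v :
  bchange_map m f (tens p v) = tens ('X_[m] * p) (f v).
Proof.
rewrite /bchange_map /tens -scalemxAl scalerA -map_mxM /=.
by rewrite (passmx.rVof_app _ (vbasisP _)).
Qed.

End BaseChange.

Section Multigraded.
Variables (k : fieldType) (n : nat).
Local Notation R := {mpoly k[n]}.
Local Notation degree := 'rV[int]_n.

Definition mdegZ (m : 'X_{1..n}) : degree := \row_i (m i)%:Z.

Definition poly_comp (d : degree) (p : R) : Prop :=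
  forall m, m \in msupp p -> mdegZ m = d.

Record mgmodule := MgModule {
  mg_sort :> lmodType R;
  mg_comp : degree -> mg_sort -> Prop }.

Definition is_basis (M : lmodType R) r (b : 'I_r -> M) : Prop :=
  forall x, exists! c : 'rV[R]_r, x = \sum_i c 0 i *: b i.

(* The gradings for which M is the direct sum of the R b_i = R(- e_i). *)
Definition mgfree (M : mgmodule) : Prop :=
  exists (r : nat) (b : 'I_r -> M) (e : 'I_r -> degree),
    is_basis b /\
    forall d x, mg_comp d x <->
      exists2 c : 'rV[R]_r,
        x = \sum_i c 0 i *: b i & forall i, poly_comp (d - e i) (c 0 i).

Definition mhbasis (M : mgmodule) r (b : 'I_r -> M) (e : 'I_r -> degree) : Prop :=
  is_basis b /\ forall i, mg_comp (e i) (b i).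

Record mgsequence := MgSequence {
  mg_term :> nat -> mgmodule;
  mg_diff : forall i, {linear mg_term i.+1 -> mg_term i} }.

Definition in_maxideal (M : lmodType R) (x : M) : Prop :=
  exists y : 'I_n -> M, x = \sum_i 'X_i *: y i.

(* The cokernel of the first differential is R/N: the augmentation is R-linear
   for the action of R on {ideal_quot N} through the projection, and
   preserves degrees. *)
Definition coker_is_quot (F : mgsequence) (N : idealr R) : Prop :=
  exists eps : F 0 -> {ideal_quot N},
    [/\ forall x y, eps (x + y) = eps x + eps y,
        forall p x, eps (p *: x) = \pi_{ideal_quot N}%qT p * eps x,
        forall q, exists x, eps x = q,
        forall x, eps x = 0 <-> exists y, mg_diff F 0 y = x
      & forall d x, mg_comp d x ->
          exists2 p, poly_comp d p & eps x = \pi_{ideal_quot N}%qT p].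

Record minimal_free_resolution (N : idealr R) (F : mgsequence) : Prop := {
  mfr_free : forall i, mgfree (F i);
  mfr_homog : forall i d (x : F i.+1), mg_comp d x -> mg_comp d (mg_diff F i x);
  mfr_complex : forall i (x : F i.+2), mg_diff F i (mg_diff F i.+1 x) = 0;
  mfr_exact : forall i (x : F i.+1), mg_diff F i x = 0 ->
    exists y : F i.+2, mg_diff F i.+1 y = x;
  mfr_coker : coker_is_quot F N;
  mfr_minimal : forall i (x : F i.+1), in_maxideal (mg_diff F i x) }.

End Multigraded.

Section Feta.
Variables (k : fieldType) (n : nat) (disp : Order.disp_t).
Variables (P : finBPOrderType disp) (eta : P -> 'X_{1..n}).
Local Notation R := {mpoly k[n]}.
Local Notation P' := {l : P | l != \bot%O}.

Definition Feta_sum (j : nat) : lmodType R :=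
  dsum (fun l : P' => bchange n (C k j (val l))).

Definition Feta_mod (i : nat) : mgmodule k n :=
  match i with
  | 0 => @MgModule k n (bchange n (C0 k P))
           (fun d u => forall c, poly_comp d (u 0 c))
  | j.+1 => @MgModule k n (Feta_sum j)
           (fun d u => forall (l : P') c, poly_comp (d - mdegZ (eta (val l))) (u l 0 c))
  end.

Definition Feta_diff1 (u : Feta_sum 0) : bchange n (C0 k P) :=
  \sum_(l : P') bchange_map (eta (val l)) (phi1 k (val l)) (u l).

(* For eta monotone and l covered by a, the subtraction of exponents is exact. *)
Definition Feta_diff2 j (u : Feta_sum j.+1) : Feta_sum j :=
  [ffun l : P' => \sum_(a : P' | covers (val l) (val a))
     bchange_map (eta (val a) - eta (val l))%MM (phi k j (val a) (val l)) (u a)].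

Fact Feta_diff1_linear : linear Feta_diff1.
Proof.
move=> a u v; rewrite /Feta_diff1 scaler_sumr -big_split; apply: eq_bigr => l _.
by rewrite dsumDE dsumZE linearP.
Qed.
HB.instance Definition _ :=
  GRing.isLinear.Build R (Feta_sum 0) (bchange n (C0 k P)) *:%R Feta_diff1
    Feta_diff1_linear.

Fact Feta_diff2_linear j : linear (@Feta_diff2 j).
Proof.
move=> a u v; apply/ffunP=> l; rewrite dsumDE dsumZE !ffunE.
rewrite scaler_sumr -big_split; apply: eq_bigr => b _.
by rewrite dsumDE dsumZE linearP.
Qed.
HB.instance Definition _ j :=
  GRing.isLinear.Build R (Feta_sum j.+1) (Feta_sum j) *:%R (@Feta_diff2 j)
    (@Feta_diff2_linear j).

Definition Feta_diff (i : nat) : {linear Feta_mod i.+1 -> Feta_mod i} :=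
  match i return {linear Feta_mod i.+1 -> Feta_mod i} with
  | 0 => Feta_diff1
  | j.+1 => @Feta_diff2 j
  end.

Definition Feta : mgsequence k n := MgSequence Feta_diff.

End Feta.

Section Dickson.
Variable n : nat.
Implicit Type A : 'X_{1..n} -> Prop.

Lemma dickson_aux d A : (d <= n)%N ->
  exists G : seq 'X_{1..n}, (forall g, g \in G -> A g) /\
    forall m, A m -> exists2 g, g \in G & forall i : 'I_n, (i < d)%N -> (g i <= m i)%N.
Proof.
elim: d A => [|d IH] A ltdn.
  case: (excluded_middle_informative (exists m, A m)) => [[m Am]|nA].
    by exists [:: m]; split=> [g|m' _]; [rewrite inE => /eqP-> | exists m; rewrite ?inE].
  by exists [::]; split=> // m Am; case: nA; exists m.
have [G [GA Gmin]] := IH A (ltnW ltdn).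
pose M := \max_(g <- G) g (Ordinal ltdn).
pose At t m := A m /\ m (Ordinal ltdn) = t.
have [H HP] : exists H : nat -> seq 'X_{1..n}, forall t,
    (forall g, g \in H t -> At t g) /\
    forall m, At t m -> exists2 g, g \in H t & forall i : 'I_n, (i < d)%N -> (g i <= m i)%N.
  exists (fun t => proj1_sig (constructive_indefinite_description _ (IH (At t) (ltnW ltdn)))).
  by move=> t; case: constructive_indefinite_description.
exists (G ++ flatten [seq H t | t <- iota 0 M]); split=> [g|m Am].
  rewrite mem_cat => /orP[/GA //|/flattenP[s /mapP[t _ ->]]].
  by case: (HP t) => h _ /h[].
have [leM|gtM] := leqP M (m (Ordinal ltdn)).
  have [g Gg gm] := Gmin m Am; exists g; first by rewrite mem_cat Gg.
  move=> i; rewrite ltnS leq_eqVlt => /orP[/eqP id|/gm //].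
  have -> : i = Ordinal ltdn by apply: val_inj.
  apply: leq_trans leM; rewrite /M (big_rem g) //=.
  exact: leq_maxl.
have [Ht1 Ht2] := HP (m (Ordinal ltdn)).
have [|g Hg gm] := Ht2 m; first by [].
exists g.
  rewrite mem_cat; apply/orP; right; apply/flattenP; exists (H (m (Ordinal ltdn))) => //.
  by apply: map_f; rewrite mem_iota.
move=> i; rewrite ltnS leq_eqVlt => /orP[/eqP id|/gm //].
have -> : i = Ordinal ltdn by apply: val_inj.
by case: (Ht1 g Hg) => _ ->.
Qed.

Definition minimal_in A m :=
  A m /\ forall m', A m' -> (m' <= m)%MM -> m' = m.

Lemma dickson A : exists G : seq 'X_{1..n},
  uniq G /\ forall m, m \in G <-> minimal_in A m.
Proof.
have [G [GA Gmin]] := dickson_aux A (leqnn n).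
pose q m : bool := if excluded_middle_informative (minimal_in A m) then true else false.
have qP m : q m <-> minimal_in A m.
  by rewrite /q; case: excluded_middle_informative.
exists (undup [seq m <- G | q m]); split=> [|m]; first exact: undup_uniq.
rewrite mem_undup mem_filter; split=> [/andP[/qP]//|mA].
apply/andP; split; first exact/qP.
have [g Gg gm] := Gmin m mA.1; have <- // : g = m.
by apply: mA.2; [exact: GA | apply/mnm_lepP=> i; apply: gm].
Qed.

End Dickson.

Fact lcm_display : Order.disp_t. Proof. exact: Order.Disp tt tt. Qed.

Section MonomialIdeal.
Variables (k : fieldType) (n : nat).
Local Notation R := {mpoly k[n]}.

(* An [idealr] is a proper ideal; the set S of monomials may be infinite. *)
Definition monomial_ideal (N : idealr R) : Prop :=
  exists S : 'X_{1..n} -> Prop, forall p : R,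
    p \in N <-> exists (r : nat) (c : 'I_r -> R) (m : 'I_r -> 'X_{1..n}),
                  (forall i, S (m i)) /\ p = \sum_i c i * 'X_[m i].

Variable N : idealr R.

(* The minimal monomial generators of N: the monomials of N that are minimal
   under divisibility. *)
Definition min_gens : seq 'X_{1..n} :=
  proj1_sig (constructive_indefinite_description _
    (dickson (fun m => 'X_[m] \in N))).

Lemma min_gens_uniq : uniq min_gens.
Proof. by rewrite /min_gens; case: constructive_indefinite_description => G []. Qed.

Lemma min_gensP m :
  m \in min_gens <-> minimal_in (fun m => 'X_[m] \in N) m.
Proof. by rewrite /min_gens; case: constructive_indefinite_description => G []. Qed.

Definition lcms : seq 'X_{1..n} :=
  [seq \big[@mlcm n/0%MM]_(g in A) ssval g | A : {set seq_sub min_gens}].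

Definition lcm_lattice : Type := seq_sub lcms.
HB.instance Definition _ := Finite.on lcm_lattice.

Definition lcm_deg (l : lcm_lattice) : 'X_{1..n} := ssval l.

Definition lcm_le (l l' : lcm_lattice) : bool := (lcm_deg l <= lcm_deg l')%MM.

Fact lcm_le_refl : reflexive lcm_le. Proof. by move=> l; apply: lepm_refl. Qed.
Fact lcm_le_anti : antisymmetric lcm_le.
Proof.
move=> l l' /andP[/mnm_lepP h /mnm_lepP h']; apply/val_inj/mnmP => i.
by apply/eqP; rewrite eqn_leq h h'.
Qed.
Fact lcm_le_trans : transitive lcm_le.
Proof. by move=> l2 l1 l3; apply: lepm_trans. Qed.
HB.instance Definition _ :=
  Order.Le_isPOrder.Build lcm_display lcm_lattice
    lcm_le_refl lcm_le_anti lcm_le_trans.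

Fact lcm0_mem : 0%MM \in lcms.
Proof. by apply/imageP; exists set0; rewrite ?big_set0. Qed.
Fact lcm_le0 (l : lcm_lattice) : (SeqSub lcm0_mem <= l :> lcm_lattice)%O.
Proof. by apply/mnm_lepP => i; rewrite mnm0E. Qed.
HB.instance Definition _ :=
  Order.hasBottom.Build lcm_display lcm_lattice lcm_le0.

Lemma lcm_deg_le (l l' : lcm_lattice) : (l <= l')%O = (lcm_deg l <= lcm_deg l')%MM.
Proof. by []. Qed.

Definition Fdeg : mgsequence k n := Feta k lcm_deg.

Definition lattice_linear : Prop :=
  exists2 F : mgsequence k n, minimal_free_resolution N F &
  exists (r : nat -> nat) (b : forall i, 'I_(r i) -> F i)
         (e : forall i, 'I_(r i) -> 'rV[int]_n),
    (forall i, mhbasis (b i) (e i)) /\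
    forall i (v : 'I_(r i.+1)) (c : 'rV[{mpoly k[n]}]_(r i)),
      mg_diff F i (b i.+1 v) = \sum_w c 0 w *: b i w ->
      forall w, c 0 w != 0 ->
        exists l a : lcm_lattice,
          [/\ e i w = mdegZ (lcm_deg l), e i.+1 v = mdegZ (lcm_deg a) & covers l a].

End MonomialIdeal.

(* Main.v *)
From Stdlib Require Import ClassicalEpsilon.
From HB Require Import structures.
Require Import Defs.
From mathcomp Require Import all_boot all_order all_algebra.
From mathcomp Require Import mpoly.

Set Implicit Arguments.
Unset Strict Implicit.
Unset Printing Implicit Defensive.

Import Order.TTheory GRing.Theory passmx.

Local Open Scope ring_scope.

(* Fix a lattice-linear basis of the minimal resolution F.  For a basis element v
   of degree a, send v to the cone with apex a over the image of its boundary; as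
   the boundary of v only involves degrees covered by a, hence strictly below a,
   this defines a chain map f from F (with all variables set to 1) to the chains
   of L_N minus its least element, compatible with the filtrations by L_N.  Over
   a principal down-set of L_N both sides are acyclic (or both are k, over the least
   element), so by induction on down-sets the mapping cone of f is acyclic over
   every down-set, in particular over the elements below a.  Together with the
   minimality of F this makes v |-> [f(dv)] an isomorphism from the span of the
   basis elements of degree a onto H(Delta_a) = C_a.  Every face of f(w) contains
   deg w, so if w has degree l covered by a then f(w) is the part of f(dv)
   supported on D_l: the Mayer-Vietoris maps phi are exactly the components of
   the differential of F, and F(deg) is isomorphic to F.  The converse is read
   off from the standard bases of F(deg). *)

(** * Chains and cones *)

(** A multidegree of F only sees the basis elements of degree at most some a, so exactness of F
    speaks about principal down-sets; the set below a is in general not one of them, which is what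
    forces the induction over all down-sets. Working with the mapping cone also absorbs the
    exception at the least element, where neither complex is acyclic but their comparison is.
    Covering, rather than mere strict inequality, is what identifies the Mayer-Vietoris maps: the
    elements covered by a are pairwise incomparable, so D_l sees the single degree l, whereas a
    basis element lying deeper below a could be seen by several D_l. The multidegrees of a basis are
    not assumed to lie in L_N, and a basis element with zero differential would escape the covering
    condition; exactness and minimality of F rule this out in positive homological degrees.
    Freeness, homogeneity and minimality of F(deg) come from its construction, so only the complex
    property, exactness and the cokernel have to be transported from F. *)

Section Cone.
Variables (k : fieldType) (disp : Order.disp_t) (P : finPOrderType disp).
Implicit Types (a : P) (s : {set P}) (c : chainsp k P) (K : {set {set P}}).

Lemma bdE c : bd k P c = \sum_(s : {set P}) (c s : k) *: bd_face k s.
Proof. by rewrite lfunE. Qed.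

Lemma restrE K c s : restr k K c s = if s \in K then c s else 0.
Proof. by rewrite lfunE ffunE. Qed.

Lemma chain_sum_face c : c = \sum_(s : {set P}) (c s : k) *: face k s.
Proof.
apply/ffunP=> t; rewrite sum_ffunE (bigD1 t) //= big1 => [|s /negPf st].
  by rewrite !ffunE eqxx addr0 /GRing.scale /= mulr1.
by rewrite !ffunE eq_sym st scaler0.
Qed.

Lemma bd_faceE s : bd k P (face k s) = bd_face k s.
Proof.
rewrite bdE (bigD1 s) //= big1 => [|t /negPf ts].
  by rewrite ffunE eqxx scale1r addr0.
by rewrite ffunE ts scale0r.
Qed.

Lemma chains_ind (Q : chainsp k P -> Prop) K j :
    Q 0 -> (forall u v, Q u -> Q v -> Q (u + v)) -> (forall x u, Q u -> Q (x *: u)) ->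
    (forall s, s \in K -> #|s| = j -> Q (face k s)) ->
  forall c, c \in chains k K j -> Q c.
Proof.
move=> Q0 QD QZ Qf c /mem_chains cK; rewrite [c]chain_sum_face.
apply: big_ind => // s _; have [->|/cK[Ks js]] := eqVneq (c s) 0.
  by rewrite scale0r.
exact/QZ/Qf.
Qed.

Lemma face_chains s K j : s \in K -> #|s| = j -> face k s \in chains k K j.
Proof.
by move=> Ks js; apply/mem_chains=> t; rewrite ffunE; case: (t =P s) => [->|_] //; rewrite eqxx.
Qed.

Lemma chains_sub K K' j : K \subset K' -> (chains k K j <= chains k K' j)%VS.
Proof.
move=> /subsetP sK; apply/subvP=> c /mem_chains cK; apply/mem_chains=> s /cK[sKs ->].
by split=> //; apply: sK.
Qed.

Lemma chains_cap K K' j c :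
  c \in chains k K j -> c \in chains k K' j -> c \in chains k (K :&: K') j.
Proof.
move=> /mem_chains cK /mem_chains cK'; apply/mem_chains=> s cs.
by have [? ?] := cK s cs; have [? _] := cK' s cs; split; rewrite // inE; apply/andP.
Qed.

Lemma bd_chains K j c :
  (forall s, s \in K -> forall a, a \in s -> s :\ a \in K) ->
  c \in chains k K j.+1 -> bd k P c \in chains k K j.
Proof.
move=> clK; apply: (@chains_ind (fun c => bd k P c \in _)) => [|u v hu hv|x u hu|s Ks js].
- by rewrite linear0 mem0v.
- by rewrite linearD memvD.
- by rewrite linearZ memvZ.
rewrite bd_faceE; apply: memv_suml => a sa; apply/memvZ/face_chains; first exact: clK.
by apply/eqP; rewrite -eqSS -js (cardsD1 a s) sa.
Qed.

Lemma bd_chains0 K c : c \in chains k K 0 -> bd k P c = 0.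
Proof.
apply: (@chains_ind (fun c => bd k P c = 0)) => [|u v hu hv|x u hu|s Ks /eqP].
- by rewrite linear0.
- by rewrite linearD /= hu hv addr0.
- by rewrite linearZ /= hu scaler0.
by rewrite cards_eq0 => /eqP->; rewrite bd_faceE /bd_face big_set0.
Qed.

(* On a face containing a the cone vanishes, which makes [cone a] a contracting
   homotopy of the whole complex of faces bounded above by a. *)
Definition cone_fun a c : chainsp k P :=
  [ffun s : {set P} => if a \in s then (-1) ^+ #|s :\ a| * (c (s :\ a) : k) else 0].

Fact cone_fun_linear a : linear (cone_fun a).
Proof.
move=> x c c'; apply/ffunP=> s; rewrite !ffunE; case: ifP => _.
  by rewrite /GRing.scale /= mulrDr mulrCA.
by rewrite scaler0 addr0.
Qed.
HB.instance Definition _ a :=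
  GRing.isLinear.Build k (chainsp k P) (chainsp k P) *:%R (cone_fun a) (cone_fun_linear a).

Definition cone a : {linear chainsp k P -> chainsp k P} := cone_fun a.

(** The sign is the one with which [bd] removes [a] again from [a |: s] when [a] lies above all of
    [s], so that this term of the boundary returns [face k s] itself. *)
Lemma cone_face a s :
  cone a (face k s) = if a \in s then 0 else (-1) ^+ #|s| *: face k (a |: s).
Proof.
apply/ffunP=> t; rewrite !ffunE; case: ifP => [at_|/negbT at_].
  have [as_|as_] := boolP (a \in s).
    have /negPf-> : t :\ a != s by apply: contraTneq as_ => <-; rewrite setD11.
    by rewrite mulr0 ffunE.
  rewrite !ffunE /GRing.scale /=; have -> : (t :\ a == s) = (t == a |: s).
    by apply/eqP/eqP => [<-|->]; rewrite ?setD1K ?setU1K.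
  by case: eqP => [->|_]; rewrite ?setU1K // !mulr0.
case: ifP => _; rewrite !ffunE //.
by case: eqP => [e|_]; rewrite ?scaler0 //; rewrite e setU11 in at_.
Qed.

(** If [a] is in [s], the cone kills [s] and every face of its boundary except [s :\ a], whose cone
    is [s] up to sign. Otherwise removing [a] from [a |: s] returns [s], and the terms removing
    another vertex cancel against the cone of the boundary. *)
Lemma bd_cone_face a s : (forall x, x \in s -> (x <= a)%O) ->
  bd k P (cone a (face k s)) + cone a (bd k P (face k s)) = face k s.
Proof.
move=> sa; rewrite cone_face bd_faceE; have [as_|as_] := boolP (a \in s).
  rewrite linear0 add0r /bd_face linear_sum (bigD1 a) //= big1 ?addr0.
    rewrite linearZ /= cone_face setD11 setD1K // scalerA.
    have -> : [set b in s | (b < a)%O] = s :\ a.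
      apply/setP=> b; rewrite !inE andbC; apply: andb_id2r => /sa.
      by rewrite lt_neqAle => ->; rewrite andbT.
    by rewrite -expr2 sqrr_sign scale1r.
  move=> x /andP[_ xa].
  by rewrite linearZ /= cone_face !inE eq_sym xa as_ scaler0.
rewrite linearZ /= bd_faceE /bd_face big_setU1 //= scalerDr.
have -> : [set b in a |: s | (b < a)%O] = s.
  apply/setP=> b; rewrite !inE; case: (b =P a) => [->|/eqP ba] /=.
    by rewrite ltxx (negPf as_).
  by case: (boolP (b \in s)) => // /sa; rewrite lt_neqAle ba => ->.
rewrite setU1K // scalerA -expr2 sqrr_sign scale1r.
rewrite -addrA -[RHS]addr0; congr (_ + _).
rewrite scaler_sumr linear_sum -big_split big1 //= => x sx.
have xa : x != a by apply: contraNneq as_ => <-.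
have -> : [set b in a |: s | (b < x)%O] = [set b in s | (b < x)%O].
  apply/setP=> b; rewrite !inE; case: (b =P a) => [->|//] /=.
  by rewrite (le_gtF (sa x sx)) andbF.
have -> : (a |: s) :\ x = a |: s :\ x.
  apply/setP=> b; rewrite !inE; case: (b =P a) => [->|_] //=.
  by rewrite eq_sym xa.
rewrite [cone_fun a _](linearZ_LR (cone a)) cone_face !inE (negPf as_) andbF !scalerA.
(* [s :\ x] has one vertex less than [s], so the two terms carry opposite signs. *)
rewrite (cardsD1 x s) sx.
by rewrite exprS mulN1r mulNr scaleNr mulrC addNr.
Qed.

Lemma bd_cone a K j c :
    (forall s, s \in K -> forall x, x \in s -> (x <= a)%O) -> c \in chains k K j ->
  bd k P (cone a c) + cone a (bd k P c) = c.
Proof.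
move=> Ka; apply: (@chains_ind (fun c => bd k P (cone a c) + cone a (bd k P c) = c))
   => [|u v hu hv|x u hu|s Ks _].
- by rewrite !linear0 addr0.
- by rewrite -{3}hu -{3}hv !linearD addrACA.
- by rewrite -{3}hu !linearZ /= scalerDr.
exact/bd_cone_face/Ka.
Qed.

Lemma cone_chains a K K' j c :
    (forall s, s \in K -> a |: s \in K') -> c \in chains k K j ->
  cone a c \in chains k K' j.+1.
Proof.
move=> KK'; apply: (@chains_ind (fun c => cone a c \in _)) => [|u v hu hv|x u hu|s Ks js].
- by rewrite linear0 mem0v.
- by rewrite linearD memvD.
- by rewrite linearZ memvZ.
rewrite cone_face; case: ifPn => sa; first exact: mem0v.
by apply/memvZ/face_chains; rewrite ?KK' // cardsU1 sa js.
Qed.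

Lemma cone_mem a c s : cone a c s != 0 -> a \in s.
Proof. by rewrite ffunE; case: ifP => //; rewrite eqxx. Qed.

Definition down a : {set P} := [set x | (x <= a)%O].
Definition below a : {set P} := [set x | (x < a)%O].

(** Makes [#|down _|] a rank function: maximizing it over a finite set yields a maximal element. *)
Lemma card_down a x : (a < x)%O -> (#|down a| < #|down x|)%N.
Proof.
move=> ax; apply: proper_card; apply/properP; split.
  by apply/subsetP=> y; rewrite !inE => /le_trans; apply; apply: ltW.
by exists x; rewrite !inE ?lexx // lt_geF.
Qed.

Lemma chain_top s x0 : x0 \in s -> {in s &, forall x y, (x >=< y)%O} ->
  exists2 a, a \in s & forall x, x \in s -> (x <= a)%O.
Proof.
move=> sx0 cs; case: (@arg_maxnP _ x0 (mem s) (fun l => #|down l|) sx0) => a sa amax.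
exists a => // x sx; have := amax x sx; rewrite /= leqNgt; apply: contraNT => xa.
have := cs a x sa sx; rewrite /Order.comparable (negPf xa) orbF le_eqVlt.
by case/orP=> [/eqP ax|/card_down//]; rewrite ax lexx in xa.
Qed.

(* A nonempty chain is the join of its top with the rest, so the contracting
   homotopy of the cone reduces the claim to smaller chains. *)
Lemma bd_bd_chain s :
  {in s &, forall x y, (x >=< y)%O} -> bd k P (bd k P (face k s)) = 0.
Proof.
have [m] := ubnP #|s|; elim: m s => // m IH s /ltnSE lsm cs.
have [->|[x0 sx0]] := set_0Vmem s.
  by rewrite bd_faceE /bd_face big_set0 linear0.
have [a sa amax] := chain_top sx0 cs.
set s' := s :\ a.
have s'a x : x \in s' -> (x <= a)%O by rewrite inE => /andP[_ /amax].
have e : face k s = (-1) ^+ #|s'| *: cone a (face k s').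
  by rewrite cone_face setD11 setD1K // scalerA -expr2 sqrr_sign scale1r.
have bd2 : bd k P (bd k P (face k s')) = 0.
  apply: IH; last by move=> x y; rewrite !inE => /andP[_ sx] /andP[_ sy]; apply: cs.
  by rewrite (leq_trans _ lsm) // [X in (_ < X)%N](cardsD1 a s) sa.
have E1 := bd_cone_face s'a.
have bdC : bd k P (bd k P (cone a (face k s'))) = 0.
  rewrite (canRL (addrK _) E1) linearB /=.
  have E2 : bd k P (cone a (bd k P (face k s'))) + cone a (bd k P (bd k P (face k s')))
     = bd k P (face k s').
    apply: (@bd_cone a [set t : {set P} | t \subset s'] #|s'|.-1).
      by move=> t; rewrite inE => /subsetP ts x /ts /s'a.
    (* For empty [s'] the predecessor is 0 by convention, which is harmless because the boundary is
       then zero. *)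
    have [/eqP|] := posnP #|s'|.
      by rewrite cards_eq0 => /eqP->; rewrite bd_faceE /bd_face big_set0 mem0v.
    move=> s'0; apply: bd_chains.
      by move=> t; rewrite inE => ts y yt; rewrite inE (subset_trans _ ts) // subsetDl.
    by rewrite prednK //; apply: face_chains; rewrite ?inE.
  by rewrite bd2 linear0 addr0 in E2; rewrite E2 subrr.
by rewrite e !linearZ /= bdC scaler0.
Qed.

End Cone.

(** * Order complexes *)

Section PosetComplexes.
Variables (disp : Order.disp_t) (P : finBPOrderType disp).
Implicit Types (a b l x y : P) (U : {set P}) (s : {set P}).

Definition downset U := forall x y, (x <= y)%O -> y \in U -> x \in U.

(* The order complex of U minus its least element, void when U is empty. *)
Definition cx U : {set {set P}} :=
  [set s : {set P} | [&& \bot%O \in U, [forall x in s, (\bot < x)%O && (x \in U)]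
             & [forall x in s, forall y in s, (x >=< y)%O]]].

Lemma cxP U s : reflect
  [/\ \bot%O \in U, forall x, x \in s -> (\bot < x)%O, {subset s <= U}
    & {in s &, forall x y, (x >=< y)%O}] (s \in cx U).
Proof.
rewrite inE; apply: (iffP and3P) => [[U0 /forall_inP sU /forall_inP cs]|[U0 s0 sU cs]].
  split=> // [x /sU/andP[]//|x /sU/andP[]//|x y sx sy].
  by have /forall_inP-> := cs x sx.
split=> //; first by apply/forall_inP=> x sx; rewrite s0 // sU.
by apply/forall_inP=> x sx; apply/forall_inP=> y sy; apply: cs.
Qed.

Lemma cx_subset U U' : U \subset U' -> cx U \subset cx U'.
Proof.
move=> /subsetP sU; apply/subsetP=> s /cxP[U0 s0 sU1 cs]; apply/cxP; split=> //.
  exact: sU.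
by move=> x /sU1; apply: sU.
Qed.

Lemma cxI U U' : cx U :&: cx U' = cx (U :&: U').
Proof.
apply/setP=> s; rewrite inE; apply/andP/cxP => [[/cxP[U0 s0 sU cs] /cxP[U0' _ sU' _]]|[]].
  by split=> //; [rewrite inE U0 | move=> x sx; rewrite inE sU ?sU'].
rewrite inE => /andP[U0 U0'] s0 sU cs.
by split; apply/cxP; split=> // x /sU; rewrite inE => /andP[].
Qed.

Lemma cx_remove U s : s \in cx U -> forall a, a \in s -> s :\ a \in cx U.
Proof.
move=> /cxP[U0 s0 sU cs] a _; apply/cxP; split=> //.
- by move=> x /setD1P[_ /s0].
- by move=> x /setD1P[_ /sU].
by move=> x y /setD1P[_ sx] /setD1P[_ sy]; apply: cs.
Qed.

Lemma Dcx_cx a : Dcx a = cx (down a).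
Proof.
apply/setP=> s; rewrite !inE le0x /=; congr (_ && _).
by apply: eq_forallb => x; rewrite inE.
Qed.

Lemma down_downset a : downset (down a).
Proof. by move=> x y xy; rewrite !inE; apply: le_trans. Qed.

Lemma below_downset a : downset (below a).
Proof. by move=> x y xy; rewrite !inE; apply: le_lt_trans. Qed.

Lemma below_down a : below a \subset down a.
Proof. by apply/subsetP=> x; rewrite !inE => /ltW. Qed.

Lemma covers_lt l a : covers l a -> (l < a)%O. Proof. by case/andP. Qed.

Lemma covers_neq_bot l a : covers l a -> a != \bot%O.
Proof. by move=> /covers_lt; apply: contraTneq => ->; rewrite ltx0. Qed.

Lemma covers_le_eq a b l : covers b a -> covers l a -> (b <= l)%O -> b = l.
Proof.
move=> /andP[ba /forallP nb] /andP[la _]; rewrite le_eqVlt => /orP[/eqP//|bl].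
by have := nb l; rewrite bl la.
Qed.

Lemma exists_cover x a : (x < a)%O -> exists2 l, (x <= l)%O & covers l a.
Proof.
move=> xa; pose Q l := ((x <= l) && (l < a))%O.
have Qx : Q x by rewrite /Q lexx.
case: (@arg_maxnP _ x Q (fun l => #|down l|) Qx) => l /andP[xl la] lmax.
exists l => //; apply/andP; split=> //; apply/forallP=> b; apply/negP=> /andP[lb ba].
have /lmax : Q b by rewrite /Q ba (le_trans xl (ltW lb)).
by apply/negP; rewrite -ltnNge; apply: card_down.
Qed.

(** A nonempty chain below [a] lies under its top, hence in D_l for any [l] covered by [a] and above
    that top; for the empty chain any [l] covered by [a] serves. At the least element both sides are
    void. *)
Lemma Delta_cx a : Delta a = cx (below a).
Proof.
apply/setP=> s; apply/bigcupP/idP => [[l la]|/cxP[]].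
  rewrite Dcx_cx; apply/subsetP/cx_subset/subsetP=> x; rewrite !inE => /le_lt_trans.
  by apply; apply: covers_lt.
rewrite inE => a0 s0 sU cs; have [s_|[x0 sx0]] := set_0Vmem s.
  have [l _ la] := exists_cover a0; exists l => //; rewrite Dcx_cx; apply/cxP.
  by rewrite s_ inE le0x; split=> // x; rewrite !inE.
have [m sm mmax] := chain_top sx0 cs.
have [|l ml la] := @exists_cover m a; first by have := sU m sm; rewrite inE.
exists l => //; rewrite Dcx_cx; apply/cxP; split=> //; first by rewrite inE le0x.
by move=> x /mmax xm; rewrite inE (le_trans xm).
Qed.

(** A face of D_l that also lies in another D_b cannot contain [l], since elements covered by [a]
    are incomparable. *)
Lemma Delta2_sub a l : covers l a -> Delta2 a l \subset Delta l.
Proof.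
move=> la; rewrite Delta_cx; apply/subsetP=> s /setIP[]; rewrite Dcx_cx => /cxP[_ s0 sl cs].
case/bigcupP=> b /andP[ba bl]; rewrite Dcx_cx => /cxP[_ _ sb _]; apply/cxP; split=> //.
  rewrite inE lt_def le0x andbT; apply: contraNneq bl => l0.
  by rewrite eq_sym; apply/eqP/(covers_le_eq la ba); rewrite l0 le0x.
move=> x sx; rewrite inE lt_neqAle; have:= sl x sx; rewrite inE => ->; rewrite andbT.
apply: contraNneq bl => xl; rewrite eq_sym; apply/eqP/(covers_le_eq la ba).
by have := sb x sx; rewrite inE xl.
Qed.

End PosetComplexes.

(** * Homology classes and inclusions of complexes *)

Section HomologyClass.
Variables (k : fieldType) (disp : Order.disp_t) (P : finPOrderType disp).
Implicit Types (K : {set {set P}}) (z : chainsp k P).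

Lemma cyclesP K j z : reflect (z \in chains k K j /\ bd k P z = 0) (z \in cycles k K j).
Proof.
by rewrite memv_cap memv_ker; apply: (iffP andP) => -[-> /eqP]; split=> //; apply/eqP.
Qed.

Lemma hclass_repr K j z : z \in cycles k K j ->
  z - hrep k K j (hclass k K j z) \in boundaries k K j.
Proof.
move=> Zz; rewrite -hclass_eq0; first by rewrite linearB /= hclassK subrr.
by rewrite memvB ?hrep_cycle.
Qed.

(** Maps between homology spaces pass through the chosen representative, which differs from [z] by a
    boundary of [K]; this is still a boundary in [K']. *)
Lemma hclass_sub K K' j z : K \subset K' -> z \in cycles k K j ->
  hclass k K' j (hrep k K j (hclass k K j z)) = hclass k K' j z.
Proof.
move=> sK Zz; apply/esym/eqP; rewrite -subr_eq0 -linearB /=.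
have Bz := hclass_repr Zz; rewrite hclass_eq0.
  exact: subvP (limgS _ (chains_sub _ _ sK)) _ Bz.
have /cyclesP[Cz bz] := memvB Zz (hrep_cycle (hclass k K j z)).
by apply/cyclesP; split=> //; apply: subvP (chains_sub _ _ sK) _ Cz.
Qed.

End HomologyClass.

(** * The Mayer-Vietoris maps on cycles *)

Section PhiFormula.
Variables (k : fieldType) (disp : Order.disp_t) (P : finBPOrderType disp).
Implicit Types (a b l x y : P) (U : {set P}) (s : {set P}) (c z : chainsp k P).

Lemma bd_chains_cx U j c : c \in chains k (cx U) j.+1 -> bd k P c \in chains k (cx U) j.
Proof. exact/bd_chains/cx_remove. Qed.

Lemma bd_bd U j c : c \in chains k (cx U) j -> bd k P (bd k P c) = 0.
Proof.
apply: (@chains_ind _ _ _ (fun c => bd k P (bd k P c) = 0)) => [|u v hu hv|x u hu|].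
- by rewrite !linear0.
- by rewrite !linearD /= hu hv addr0.
- by rewrite !linearZ /= hu scaler0.
by move=> s /cxP[_ _ _ cs] _; apply: bd_bd_chain.
Qed.

Lemma Delta_other a l c j : c \in chains k (Delta a) j ->
  c - restr k (Dcx l) c \in chains k (\bigcup_(b | covers b a && (b != l)) Dcx b) j.
Proof.
move=> /mem_chains cD; apply/mem_chains=> s; rewrite !ffunE restrE.
case: ifPn => [_|sl]; first by rewrite subrr eqxx.
rewrite subr0 => /cD[/bigcupP[b ba sb] ->]; split=> //; apply/bigcupP; exists b => //.
by rewrite ba; apply: contraNneq sl => <-.
Qed.

Lemma bd_other a l c j :
    c \in chains k (\bigcup_(b | covers b a && (b != l)) Dcx b) j.+1 ->
  bd k P c \in chains k (\bigcup_(b | covers b a && (b != l)) Dcx b) j.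
Proof.
apply: bd_chains => s /bigcupP[b bal]; rewrite Dcx_cx => sb x sx; apply/bigcupP.
by exists b => //; rewrite Dcx_cx; apply: cx_remove.
Qed.

Lemma restr_chains a l c j : c \in chains k (Delta a) j ->
  restr k (Dcx l) c \in chains k (Dcx l) j.
Proof.
move=> /mem_chains cD; apply/mem_chains=> s; rewrite restrE.
by case: ifP => [sl /cD[]|]; rewrite ?eqxx.
Qed.

(** Since [z] is a cycle, the boundary of its part on D_l is minus the boundary of the rest, hence
    supported on both sides. *)
Lemma connecting_cycle a l z j : z \in cycles k (Delta a) j.+1 ->
  bd k P (restr k (Dcx l) z) \in cycles k (Delta2 a l) j.
Proof.
move=> /cyclesP[Cz bz]; have Cr := restr_chains l Cz; apply/cyclesP; split; last first.
  by move: Cr; rewrite Dcx_cx => /bd_bd.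
apply: chains_cap; first by move: Cr; rewrite Dcx_cx => /bd_chains_cx.
have := bd_other (Delta_other l Cz).
by rewrite linearB /= bz sub0r memvN.
Qed.

(** Frees the connecting map from the representative built into it. Two representatives differ by
    the boundary of some [w], and the part of [w] on D_l contributes nothing after applying [bd]
    twice. *)
Lemma connectingE a l z j : z \in cycles k (Delta a) j.+1 ->
  connecting k j a l (hclass k (Delta a) j.+1 z)
    = hclass k (Delta2 a l) j (bd k P (restr k (Dcx l) z)).
Proof.
move=> Zz; have -> (x : C k j.+1 a) : connecting k j a l x =
    hclass k (Delta2 a l) j (bd k P (restr k (Dcx l) (hrep k (Delta a) j.+1 x))).
  by rewrite !comp_lfunE.
apply/esym/eqP.
set h := hrep _ _ _ _; rewrite -subr_eq0.
have -> : hclass k (Delta2 a l) j (bd k P (restr k (Dcx l) z))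
    - hclass k (Delta2 a l) j (bd k P (restr k (Dcx l) h))
    = hclass k (Delta2 a l) j (bd k P (restr k (Dcx l) (z - h))) by rewrite !linearB.
rewrite hclass_eq0; last by apply: connecting_cycle; rewrite memvB // hrep_cycle.
have [w Cw ->] := memv_imgP (hclass_repr Zz).
set L := Dcx l; set w' := restr k L w.
have Cw' : w' \in chains k (Dcx l) j.+2 := restr_chains l Cw.
have Co := bd_other (Delta_other l Cw); rewrite -/L -/w' in Co.
(* [restr] does not commute with [bd]; the defect, the last summand, lies both in D_l and in the
   other D_b, so its boundary is a boundary in [Delta2 a l]. *)
have -> : restr k L (bd k P w) = bd k P w' + restr k L (bd k P (w - w')).
  suff -> : restr k L (bd k P (w - w')) = restr k L (bd k P w) - bd k P w' by rewrite addrC subrK.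
  rewrite !linearB /=; congr (_ - _); apply/ffunP=> s; rewrite restrE; case: ifPn => // sL.
  move: Cw'; rewrite Dcx_cx => /bd_chains_cx /mem_chains Cb.
  by have [//|/Cb[]] := eqVneq (bd k P w' s) 0; rewrite -Dcx_cx (negPf sL).
rewrite linearD /=; have -> : bd k P (bd k P w') = 0.
  by move: Cw'; rewrite Dcx_cx => /bd_bd.
rewrite add0r; apply: memv_img; apply: chains_cap.
  move/mem_chains: Co => Co; apply/mem_chains=> s; rewrite restrE.
  by case: ifP => [sL /Co[_ ->]|]; rewrite ?eqxx.
move/mem_chains: Co => Co; apply/mem_chains=> s; rewrite restrE.
by case: ifP => [sL /Co//|]; rewrite ?eqxx.
Qed.

Lemma phiE a l z j : covers l a -> z \in cycles k (Delta a) j.+1 ->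
  phi k j a l (hclass k (Delta a) j.+1 z)
    = hclass k (Delta l) j (bd k P (restr k (Dcx l) z)).
Proof.
move=> la Zz; have -> (x : C k j.+1 a) : phi k j a l x =
    hclass k (Delta l) j (hrep k (Delta2 a l) j (connecting k j a l x)).
  by rewrite !comp_lfunE.
rewrite connectingE // hclass_sub //.
  exact: Delta2_sub.
exact: connecting_cycle.
Qed.

Lemma Delta_atom a : covers \bot%O a -> Delta a = [set set0].
Proof.
move=> ca; rewrite Delta_cx; apply/setP=> s; rewrite in_set1; apply/cxP/eqP => [[_ s0 sa _]|->].
  apply/eqP; rewrite -subset0; apply/subsetP=> x sx.
  have := sa x sx; rewrite !inE; case/andP: ca => _ /forallP/(_ x).
  by rewrite s0 //= => /negPf->.
by split=> [|x|x|x y]; rewrite inE // covers_lt.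
Qed.

Lemma phi1E a z : covers \bot%O a -> z \in cycles k (Delta a) 0 ->
  phi1 k a (hclass k (Delta a) 0 z) = hclass k [set set0] 0 z.
Proof.
move=> ca Zz; have -> (x : C k 0 a) : phi1 k a x = hclass k [set set0] 0 (hrep k (Delta a) 0 x).
  by rewrite /phi1 ca !comp_lfunE.
by rewrite hclass_sub // Delta_atom.
Qed.

End PhiFormula.

(** * Acyclicity over down-sets *)

Section FilteredAcyclic.
Variables (disp : Order.disp_t) (P : finBPOrderType disp).
Variables (T : nat -> zmodType) (D : forall i, {additive T i.+1 -> T i}).
(** [S U] is the part of the complex lying over [U]. The filtration is kept abstract; the hypotheses
    below are what a Mayer-Vietoris argument for two down-sets uses. *)
Variable S : forall i, {set P} -> T i -> Prop.
Implicit Types U : {set P}.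

(** No differential leaves position 0, so acyclicity there means that [D 0] is onto. *)
Definition cyc i : T i -> Prop :=
  match i with 0 => fun=> True | j.+1 => fun x => D j x = 0 end.

Definition acyclic U :=
  forall i (x : T i), S U x -> cyc x -> exists2 y : T i.+1, S U y & D i y = x.

Hypothesis SB : forall i U (x y : T i), S U x -> S U y -> S U (x - y).
Hypothesis SI : forall i U U' (x : T i), S U x -> S U' x -> S (U :&: U') x.
Hypothesis SM : forall i U U' (x : T i), U \subset U' -> S U x -> S U' x.
Hypothesis SZ : forall i U, S U (0 : T i).
Hypothesis S0 : forall i (x : T i), S set0 x -> x = 0.
Hypothesis SD : forall i U (x : T i.+1), downset U -> S U x -> S U (D i x).
Hypothesis S_split : forall i U a (x : T i), a \in U ->
  {in U, forall y, (a <= y)%O -> y = a} -> S U x ->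
  exists2 x1, S (U :&: down a) x1 & S (U :\ a) (x - x1).
Hypothesis DD : forall i U (x : T i.+1), S U x -> cyc (D i x).
Hypothesis ac_down : forall a, acyclic (down a).

Lemma cycB i (x y : T i) : cyc x -> cyc y -> cyc (x - y).
Proof. by case: i x y => //= i x y hx hy; rewrite raddfB hx hy subr0. Qed.

(** For a maximal [a], [U] is the union of [down a] and [U :\ a], which meet in [below a]. The first
    is acyclic by hypothesis and the other two by induction on the cardinality, so a Mayer-Vietoris
    argument reaches [U]. *)
Lemma filtered_acyclic U : downset U -> acyclic U.
Proof.
have [m] := ubnP #|U|; elim: m U => // m IH U /ltnSE leUm dU.
have [->|[x0 Ux0]] := set_0Vmem U.
  by move=> i x /S0-> _; exists 0; [apply: SZ | rewrite raddf0].
case: (@arg_maxnP _ x0 (mem U) (fun l => #|down l|) Ux0) => a Ua amax.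
have {amax} maxa : {in U, forall y, (a <= y)%O -> y = a}.
  move=> y Uy; rewrite le_eqVlt => /orP[/eqP//|ay].
  by have := amax y Uy; rewrite /= leqNgt (card_down ay).
have dUa : downset (U :\ a).
  move=> x y xy; rewrite !inE => /andP[ya Uy]; rewrite (dU x y) // andbT.
  by apply: contraNneq ya => xa; rewrite (maxa y) // -xa.
have cUa : (#|U :\ a| < m)%N.
  have {}Ua : a \in U by []; apply: leq_trans leUm; apply: proper_card; exact: properD1.
have acUa := IH _ cUa dUa.
have sba : below a \subset U :\ a.
  apply/subsetP=> x; rewrite !inE => xa; rewrite (lt_eqF xa) /=.
  exact: dU (ltW xa) Ua.
have acb : acyclic (below a).
  by apply: IH (@below_downset _ _ a); apply: leq_ltn_trans (subset_leq_card sba) cUa.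
have sda : down a \subset U.
  by apply/subsetP=> x; rewrite inE => xa; apply: dU xa Ua.
(* [u], found in [below a], cancels the boundary of [x1], so that both [x1 - u] and
   [x - x1 + u] are cycles. *)
move=> i x Sx cx_; have [x1 S1 S2] := S_split Ua maxa Sx.
have {}S1 : S (down a) x1 by apply: SM S1; apply: subsetIr.
have [u Su Cu] : exists2 u : T i, S (below a) u & cyc (x1 - u).
  case: i x cx_ x1 S1 S2 {Sx} => [|i] x cx_ x1 S1 S2; first by exists 0 => //; apply: SZ.
  have [||u Su Du] := acb i (D i x1); [|exact: DD S1|by exists u; rewrite //= raddfB Du subrr].
  (* As [x] is a cycle, the differential of [x1] is minus that of [x - x1], so it lies over both
     pieces and hence over their intersection. *)
  have -> : below a = down a :&: (U :\ a).
    apply/setP=> y; rewrite !inE lt_neqAle; case: (boolP (y <= a)%O) => [ya|]; rewrite ?andbF //.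
    by rewrite (dU _ _ ya Ua) !andbT.
  apply: SI; first exact: SD (@down_downset _ _ a) S1.
  have -> : D i x1 = - D i (x - x1) by rewrite raddfB /= [D i x]cx_ sub0r opprK.
  by rewrite -sub0r; apply: SB; [apply: SZ | apply: SD].
have [|//|w Sw Dw] := ac_down (i := i) (x := x1 - u) (a := a).
  by apply: SB S1 _; apply: SM Su; apply: below_down.
have e : x - x1 + u = x - (x1 - u) by rewrite opprB addrA addrAC.
have [||v Sv Dv] := acUa i (x - x1 + u).
- by rewrite -[u]opprK -[- u]sub0r; apply: SB S2 _; apply: SB (SZ _ _) _; apply: SM Su.
- by rewrite e; apply: cycB.
exists (v + w); last by rewrite raddfD /= Dv Dw e subrK.
rewrite -[w]opprK -[- w]sub0r; apply: SB; last by apply: SB (SZ _ _) _; apply: SM Sw.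
by apply: SM Sv; apply: subsetDl.
Qed.

End FilteredAcyclic.

(** * The homology of the open intervals *)

Section Strand.
Variables (k : fieldType) (disp : Order.disp_t) (P : finBPOrderType disp).
Variables (r : nat -> nat) (deg : forall i, 'I_(r i) -> P).
Variable M : forall i, 'M[k]_(r i.+1, r i).

Definition supp_in i (U : {set P}) (u : 'rV[k]_(r i)) :=
  forall v, u 0 v != 0 -> deg v \in U.

(* The dehomogenization of a lattice-linear resolution of R/N: exactness of its
   truncation below a is exactness of the resolution in degree a. *)
Record strands : Prop := Strands {
  M_covers : forall i v w, M i v w != 0 -> covers (deg w) (deg v);
  M_complex : forall i, M i.+1 *m M i = 0;
  M_exact : forall a, a != \bot%O -> forall i (u : 'rV_(r i.+1)), supp_in (down a) u ->
    u *m M i = 0 -> exists2 u', supp_in (down a) u' & u' *m M i.+1 = u;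
  M_exact0 : forall a, a != \bot%O -> forall u : 'rV_(r 0),
    exists2 u', supp_in (down a) u' & u' *m M 0 = u;
  r0_eq1 : r 0 = 1%N;
  deg0_bot : forall w : 'I_(r 0), deg w = \bot%O;
  degS_bot : forall i (v : 'I_(r i.+1)), deg v != \bot%O }.

Hypothesis HM : strands.

Fixpoint cone_basis i : 'I_(r i) -> chainsp k P :=
  match i with
  | 0 => fun=> face k set0
  | j.+1 => fun v => cone k (deg v) (\sum_w (M j v w : k) *: cone_basis w)
  end.

Definition cone_map i (u : 'rV[k]_(r i)) : chainsp k P := \sum_w u 0 w *: cone_basis w.

Fact cone_map_linear i : linear (@cone_map i).
Proof.
move=> x u v; rewrite /cone_map scaler_sumr -big_split; apply: eq_bigr => w _.
by rewrite !mxE scalerDl scalerA.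
Qed.
HB.instance Definition _ i :=
  GRing.isLinear.Build k 'rV[k]_(r i) (chainsp k P) *:%R (@cone_map i) (@cone_map_linear i).

Lemma cone_map_row j (v : 'I_(r j.+1)) :
  \sum_w (M j v w : k) *: cone_basis w = cone_map (row v (M j)).
Proof. by apply: eq_bigr => w _; rewrite mxE. Qed.

Lemma cone_map_chains_of i U (u : 'rV[k]_(r i)) : downset U ->
    (forall w : 'I_(r i), cone_basis w \in chains k (cx (down (deg w))) i) ->
  supp_in U u -> cone_map u \in chains k (cx U) i.
Proof.
move=> dU hb uU; apply: memv_suml => w _.
have [->|/uU dw] := eqVneq (u 0 w) 0; first by rewrite scale0r mem0v.
apply: memvZ; apply: subvP (hb w); apply/chains_sub/cx_subset/subsetP=> x.
by rewrite inE => /dU; apply.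
Qed.

Lemma r0_unique : exists w0 : 'I_(r 0), forall w, w = w0.
Proof.
have e := r0_eq1 HM; exists (cast_ord (esym e) ord0) => w; apply: ord_inj => /=.
by have := leq_trans (ltn_ord w) (eq_leq e); rewrite ltnS leqn0 => /eqP.
Qed.

Lemma cone_map0 (w0 : 'I_(r 0)) u : cone_map u = u 0 w0 *: face k set0.
Proof.
have [w1 w1P] := r0_unique; rewrite /cone_map (bigD1 w0) //= big1 ?addr0 // => w.
by rewrite (w1P w) (w1P w0) eqxx.
Qed.

Lemma row_supp i (v : 'I_(r i.+1)) : supp_in (below (deg v)) (row v (M i)).
Proof. by move=> w; rewrite mxE inE => /(M_covers HM)/covers_lt. Qed.

Lemma cone_basis_chains i (w : 'I_(r i)) : cone_basis w \in chains k (cx (down (deg w))) i.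
Proof.
elim: i w => [|i IH] w.
  by apply: face_chains; rewrite ?cards0 //; apply/cxP; rewrite inE le0x; split=> // x; rewrite inE.
rewrite /= cone_map_row.
have := cone_map_chains_of (@below_downset _ _ (deg w)) IH (@row_supp i w).
apply: cone_chains => s /cxP[_ s0 sb cs]; apply/cxP; split.
- by rewrite inE le0x.
- by move=> x /setU1P[->|/s0//]; rewrite lt_def le0x (degS_bot HM).
- by move=> x /setU1P[->|/sb]; rewrite !inE // => /ltW.
move=> x y /setU1P[->|sx] /setU1P[->|sy]; first exact: comparablexx.
- by have := sb y sy; rewrite inE => /ltW h; rewrite /Order.comparable h orbT.
- by have := sb x sx; rewrite inE => /ltW h; rewrite /Order.comparable h.
exact: cs.
Qed.

Lemma cone_map_chains i U (u : 'rV[k]_(r i)) : downset U -> supp_in U u ->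
  cone_map u \in chains k (cx U) i.
Proof. by move=> dU; apply: cone_map_chains_of (@cone_basis_chains i). Qed.

(** By induction the chain under the apex of a basis element is itself a cycle, because consecutive
    differentials compose to zero; the homotopy formula then says that the boundary of its cone is
    that chain. *)
Lemma bd_cone_map i (u : 'rV[k]_(r i.+1)) : bd k P (cone_map u) = cone_map (u *m M i).
Proof.
have mulE j (y : 'rV[k]_(r j.+1)) : cone_map (y *m M j) = \sum_v y 0 v *: cone_map (row v (M j)).
  rewrite mulmx_sum_row linear_sum; apply: eq_bigr => v _; exact: linearZ.
elim: i u => [|i IH] u; rewrite mulE linear_sum; apply: eq_bigr => v _;
  rewrite linearZ; congr (_ *: _); rewrite /= cone_map_row.
  have h := cone_map_chains (@below_downset _ _ (deg v)) (@row_supp _ v).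
  have := bd_cone (a := deg v) _ h; rewrite (bd_chains0 h) linear0 addr0; apply.
  by move=> s /cxP[_ _ sb _] x /sb; rewrite inE => /ltW.
have h := cone_map_chains (@below_downset _ _ (deg v)) (@row_supp _ v).
have := bd_cone (a := deg v) _ h; rewrite IH -row_mul (M_complex HM) row0 !linear0 addr0; apply.
by move=> s /cxP[_ _ sb _] x /sb; rewrite inE => /ltW.
Qed.

Lemma mulM_neq0 i (u : 'rV[k]_(r i.+1)) w :
  (u *m M i) 0 w != 0 -> exists2 v, u 0 v != 0 & covers (deg w) (deg v).
Proof.
rewrite mxE => nz; have /existsP[v] : [exists v, u 0 v * M i v w != 0].
  apply: contraNT nz; rewrite negb_exists => /forallP z.
  by rewrite big1 // => v _; have := z v; rewrite negbK => /eqP.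
by rewrite mulf_eq0 negb_or => /andP[uv /(M_covers HM)]; exists v.
Qed.

Lemma mulM_supp i U (u : 'rV[k]_(r i.+1)) : downset U -> supp_in U u -> supp_in U (u *m M i).
Proof. by move=> dU uU w /mulM_neq0[v /uU dv /covers_lt/ltW/dU]; apply. Qed.

Lemma mulM_supp_below i a (u : 'rV[k]_(r i.+1)) :
  supp_in (down a) u -> supp_in (below a) (u *m M i).
Proof.
move=> uU w /mulM_neq0[v /uU]; rewrite !inE => va /covers_lt wv.
exact: lt_le_trans wv va.
Qed.

(* Position i of the mapping cone of [cone_map] pairs the chains of cardinality i
   with position i - 1 of the given complex. *)
Definition shift_rank i := if i is j.+1 then r j else 0%N.
Definition shift_deg i : 'I_(shift_rank i) -> P :=
  match i with 0 => fun=> \bot%O | j.+1 => fun w => deg w end.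
Definition shift_mx i : 'M[k]_(shift_rank i.+1, shift_rank i) :=
  match i with 0 => 0 | j.+1 => M j end.

Definition mcone i : zmodType := (chainsp k P * 'rV[k]_(shift_rank i))%type.

Definition mcone_diff_fun i (x : mcone i.+1) : mcone i :=
  (bd k P x.1 - cone_map (x.2 : 'rV[k]_(r i)), - (x.2 *m shift_mx i)).

Fact mcone_diff_additive i : additive (@mcone_diff_fun i).
Proof.
move=> x y; have E : cone_map ((x - y).2 : 'rV[k]_(r i)) =
  cone_map (x.2 : 'rV[k]_(r i)) - cone_map (y.2 : 'rV[k]_(r i)) := linearB _ _ _.
rewrite /mcone_diff_fun E; apply: injective_projections; rewrite /=.
  by rewrite linearB !opprD addrACA.
by rewrite mulmxBl opprD.
Qed.
HB.instance Definition _ i :=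
  GRing.isAdditive.Build (mcone i.+1) (mcone i) (@mcone_diff_fun i) (@mcone_diff_additive i).

Definition mcone_supp i (U : {set P}) (x : mcone i) :=
  x.1 \in chains k (cx U) i /\ forall v, x.2 0 v != 0 -> shift_deg v \in U.

(** For [a] other than the least element, exactness of the strand gives [z] with differential [y],
    and the remaining cycle [s - cone_map z] is filled by the cone with apex [a]. At the least
    element both complexes are one copy of k, identified by [cone_map]. *)
Lemma mcone_acyclic_down a : acyclic (@mcone_diff_fun) mcone_supp (down a).
Proof.
move=> i [s y] [/= Ss Sy] cy; have [a0|a0] := eqVneq a \bot%O; last first.
  have [z Sz zy] : exists2 z : 'rV[k]_(r i), supp_in (down a) z & z *m shift_mx i = y.
    case: i y Sy Ss cy => [|[|i]] y Sy Ss cy.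
    - by exists 0 => [v|]; [rewrite mxE eqxx | apply/rowP=> -[]].
    - exact: (M_exact0 HM).
    apply: (M_exact HM) => //; apply/eqP; rewrite -oppr_eq0; apply/eqP.
    by case: cy.
  have Cz : cone_map z \in chains k (cx (down a)) i.
    exact: cone_map_chains (@down_downset _ _ a) Sz.
  have bdz : bd k P s = bd k P (cone_map z).
    case: i y Ss Sy cy z Sz zy Cz => [|i] y Ss Sy cy z Sz zy Cz.
      by rewrite (bd_chains0 Ss) (bd_chains0 Cz).
    rewrite bd_cone_map; case: cy => /eqP; rewrite subr_eq0 => /eqP -> _.
    by rewrite -zy.
  exists (cone k a (s - cone_map z), - z).
    split=> /=; last by move=> v; rewrite mxE oppr_eq0; apply: Sz.
    apply: cone_chains (memvB Ss Cz) => t /cxP[_ t0 ta ct]; apply/cxP; split.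
    - by rewrite inE le0x.
    - by move=> x /setU1P[->|/t0//]; rewrite lt_def le0x a0.
    - by move=> x /setU1P[->|/ta//]; rewrite inE.
    have ta' x : x \in t -> (x <= a)%O by move/ta; rewrite inE.
    move=> x y' /setU1P[->|tx] /setU1P[->|ty]; first exact: comparablexx.
    - by rewrite /Order.comparable ta' ?orbT.
    - by rewrite /Order.comparable ta'.
    exact: ct.
  have E := bd_cone (a := a) (K := cx (down a)) _ (memvB Ss Cz).
  congr (_, _) => /=; last by rewrite mulNmx opprK.
  rewrite (linearN (@cone_map i)) opprK -[X in X + _]addr0.
  rewrite -[X in _ + X + _](linear0 (cone k a)) -[X in cone k a X](subrr (bd k P s)).
  rewrite {2}bdz -linearB E ?subrK // => t /cxP[_ _ ta _] x /ta; by rewrite inE.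
have s0_ (t : {set P}) : t \in cx (down \bot%O) -> t = set0.
  move=> /cxP[_ t0 ta _]; apply/eqP; rewrite -subset0; apply/subsetP=> x tx.
  by have := ta x tx; rewrite inE lex0 => /eqP xb; have := t0 x tx; rewrite xb ltxx.
rewrite a0 in Ss Sy *; have {}Ss : s \in chains k [set set0] i.
  by apply: subvP (chains_sub _ _ _) _ Ss; apply/subsetP=> t /s0_->; rewrite inE.
have [w0 w0P] := r0_unique.
case: i y s Sy Ss cy => [|i] y s Sy Ss cy.
  (* Here [s] is a multiple of the empty face, which is the image of the only generator; the sign
     undoes that of [cone_map] in the differential. *)
  exists (0, const_mx (- (s set0 : k))) => /=.
    split=> [|v _] /=; first exact: mem0v.
    by rewrite (deg0_bot HM) inE.
  apply: injective_projections => /=; last by apply/rowP=> -[].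
  rewrite linear0 sub0r (cone_map0 w0) mxE scaleNr opprK.
  rewrite [RHS]chain_sum_face (bigD1 set0) //= big1 ?addr0 // => t t0.
  have [->|] := eqVneq (s t) 0; first by rewrite scale0r.
  by move/mem_chains: Ss => Ss /Ss[]; rewrite inE (negPf t0).
have s0 : s = 0.
  apply/ffunP=> t; rewrite ffunE; apply/eqP; apply: contraT.
  by move/mem_chains: Ss => Ss /Ss[]; rewrite inE => /eqP->; rewrite cards0.
(* In position 1 the cycle condition says that [y] has zero image, and the single generator maps to
   a nonzero chain; in later positions no basis element has the least degree. *)
have y0 : y = 0.
  case: i y Sy cy {Ss} => [|i] y Sy; last first.
    move=> _; apply/rowP=> v; rewrite mxE; apply/eqP; apply: contraT => /Sy.
    by rewrite inE lex0 (negPf (degS_bot HM _)).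
  case; rewrite s0 linear0 sub0r (cone_map0 w0) => /eqP; rewrite oppr_eq0 scaler_eq0 => /orP[|].
    by move=> /eqP y0 _; apply/rowP=> w; rewrite mxE (w0P w).
  by move=> /eqP/ffunP/(_ set0)/eqP; rewrite !ffunE eqxx oner_eq0.
rewrite s0 y0; exists 0; last exact: raddf0 (@mcone_diff_fun i.+1).
by split=> [|v]; rewrite /= ?mem0v // mxE eqxx.
Qed.

Lemma mcone_acyclic U : downset U -> acyclic (@mcone_diff_fun) mcone_supp U.
Proof.
apply: filtered_acyclic.
- move=> i {}U x y [/= sx dx] [/= sy dy]; split=> /=; first exact: memvB.
  move=> v; have [x0|/dx//] := eqVneq (x.2 0 v) 0.
  by rewrite mxE x0 add0r mxE oppr_eq0 => /dy.
- move=> i A B [s y] [/= sA yA] [/= sB yB]; split=> /=.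
    by rewrite -cxI; apply: chains_cap.
  by move=> v nv; rewrite inE yA ?yB.
- move=> i A B [s y] AB [/= sA yA]; split=> /=.
    exact: subvP (chains_sub _ _ (cx_subset AB)) _ sA.
  by move=> v /yA; apply/subsetP.
- by move=> i A; split=> [|v] /=; rewrite ?mem0v // mxE eqxx.
- move=> i [s y] [/= /mem_chains s0 y0]; apply: injective_projections => /=.
    apply/ffunP=> t; rewrite ffunE; apply/eqP; apply: contraT => /s0[/cxP[]].
    by rewrite inE.
  by apply/rowP=> v; rewrite mxE; apply/eqP; apply: contraT => /y0; rewrite inE.
- move=> i A x dA [/= sx yx]; split=> /=.
    by apply: memvB; [apply: bd_chains_cx | apply: cone_map_chains].
  move=> v; rewrite mxE oppr_eq0; case: i x sx yx v => [|i] x sx yx v; first by case: v.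
  by apply: (mulM_supp (u := (x.2 : 'rV_(r i.+1)))).
- move=> i A a [s y] Aa maxa [/= sA yA].
  (* Faces through the maximal element [a] lie in [down a], the others avoid [a]. The least element
     belongs to no face, but without it the complex is void; so if [a] is the least element all
     faces go to the first part. *)
  exists (restr k [set t : {set P} | (a \in t) || (a == \bot%O)] s,
          \row_v (if shift_deg v == a then y 0 v else 0)).
    split=> /=.
      move/mem_chains: sA => sA; apply/mem_chains=> t; rewrite restrE inE.
      case: ifP => [ta /sA[/cxP[A0 t0 tA ct] ->]|]; last by rewrite eqxx.
      split=> //; apply/cxP; split=> //; first by rewrite !inE A0 le0x.
      move=> x tx; rewrite !inE tA //=; case/orP: ta => [ta|/eqP a0].
        have := ct a x ta tx; rewrite /Order.comparable => /orP[ax|//].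
        by rewrite (maxa x) ?lexx ?tA.
      by have := maxa x (tA x tx); rewrite a0 le0x => ->.
    move=> v; rewrite mxE; case: (shift_deg v =P a) => [va nv|_]; last by rewrite eqxx.
    by rewrite !inE va lexx Aa.
  split=> /=.
    move/mem_chains: sA => sA; apply/mem_chains=> t; rewrite !ffunE restrE inE.
    case: ifPn => [_|]; first by rewrite subrr eqxx.
    rewrite negb_or subr0 => /andP[ta a0] /sA[/cxP[A0 t0 tA ct] ->].
    split=> //; apply/cxP; split=> //; first by rewrite !inE eq_sym a0.
    by move=> x tx; rewrite !inE tA // andbT; apply: contraNneq ta => <-.
  move=> v; rewrite !mxE !inE; case: ifPn => [_|va]; first by rewrite subrr eqxx.
  by rewrite subr0 => /yA ->.
- move=> [|i] A [s y] [/= sA yA] //=; apply: injective_projections => /=.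
    rewrite linearB /= (bd_bd sA) sub0r bd_cone_map (linearN (@cone_map i)) opprK /=.
    by rewrite addNr.
  rewrite mulNmx opprK -mulmxA; case: i s y sA yA => [|i] s y sA yA /=; first by rewrite !mulmx0.
  by rewrite (M_complex HM) mulmx0.
exact: mcone_acyclic_down.
Qed.

Definition graded_part i a (u : 'rV[k]_(r i)) : 'rV[k]_(r i) :=
  \row_v (if deg v == a then u 0 v else 0).

Definition hmap j a (u : 'rV[k]_(r j.+1)) : C k j a :=
  hclass k (Delta a) j (cone_map (u *m M j)).

Fact hmap_linear j a : linear (@hmap j a).
Proof.
move=> x u v; rewrite /hmap mulmxDl -scalemxAl.
by rewrite (linearP (@cone_map j)) linearP.
Qed.
HB.instance Definition _ j a :=
  GRing.isLinear.Build k 'rV[k]_(r j.+1) (C k j a) *:%R (@hmap j a) (@hmap_linear j a).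

Definition hmap0 (u : 'rV[k]_(r 0)) : C0 k P := hclass k [set set0] 0 (cone_map u).

Fact hmap0_linear : linear hmap0.
Proof. by move=> x u v; rewrite /hmap0 (linearP (@cone_map 0)) linearP. Qed.
HB.instance Definition _ :=
  GRing.isLinear.Build k 'rV[k]_(r 0) (C0 k P) *:%R hmap0 hmap0_linear.

Lemma supp1_down i a (u : 'rV[k]_(r i)) : supp_in [set a] u -> supp_in (down a) u.
Proof. by move=> ua v /ua; rewrite !inE => /eqP->. Qed.

Lemma cone_map_cycle j a (u : 'rV[k]_(r j.+1)) : supp_in (down a) u ->
  cone_map (u *m M j) \in cycles k (Delta a) j.
Proof.
move=> ua; have := cone_map_chains (@below_downset _ _ a) (mulM_supp_below ua).
rewrite -Delta_cx => Cu; apply/cyclesP; split=> //.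
case: j u {ua} Cu => [|j] u Cu; first exact: bd_chains0 Cu.
by rewrite bd_cone_map -mulmxA (M_complex HM) mulmx0 (linear0 (@cone_map j)).
Qed.

Lemma mulM_shift_mx j (u : 'rV[k]_(r j.+1)) : u *m M j *m shift_mx j = 0.
Proof. by case: j u => [|j] u /=; rewrite ?mulmx0 // -mulmxA (M_complex HM) mulmx0. Qed.

Lemma shift_mx_exact j a (u : 'rV[k]_(r j)) : a != \bot%O -> supp_in (down a) u ->
  u *m shift_mx j = 0 -> exists2 u', supp_in (down a) u' & u' *m M j = u.
Proof.
by case: j u => [|j] u a0 ua uM; [apply: (M_exact0 HM) | apply: (M_exact HM)].
Qed.

(** If the class vanishes, acyclicity over [below a] yields [z] supported there such that [z + u] is
    a cycle of the strand at [a], hence a boundary. Differentials strictly lower degrees, so a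
    boundary has no component of degree [a], and that component is [u]. *)
Lemma hmap_inj j a (u : 'rV[k]_(r j.+1)) : a != \bot%O -> supp_in [set a] u ->
  hmap a u = 0 -> u = 0.
Proof.
move=> a0 ua /eqP; have ud := supp1_down ua.
rewrite hclass_eq0; last exact: cone_map_cycle.
case/memv_imgP=> t; rewrite Delta_cx => Ct et.
have [||[t' z] [/= _ Sz] []] := @mcone_acyclic _ (@below_downset _ _ a) j.+1 (t, u *m M j).
- by split=> //=; apply: mulM_supp_below.
- by rewrite /= /mcone_diff_fun /= et subrr mulM_shift_mx oppr0.
move=> _ zM; have [||z' Sz' z'M] := M_exact HM (u := z + u) a0.
- move=> v; rewrite mxE; have [z0|/Sz zv _] := eqVneq (z 0 v) 0; first by rewrite z0 add0r => /ud.
  by apply: subsetP zv; apply: below_down.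
- by rewrite mulmxDl -zM addrN.
apply/rowP=> v; rewrite mxE; apply/eqP; apply: contraT => uv.
have /eqP va : deg v == a by have := ua v uv; rewrite inE.
have zv : z 0 v = 0.
  by apply/eqP; apply: contraT => /Sz; rewrite /= va inE ltxx.
have := @mulM_supp_below _ _ _ Sz' v.
by rewrite z'M mxE zv add0r va inE ltxx => /(_ uv).
Qed.

(** A cycle [c] of [Delta a] is a cycle of the mapping cone over [below a], so [c] is a boundary
    minus [cone_map z] with [z] a cycle. In the larger strand at [a], [z] is the differential of
    some [y]; the part of [y] below [a] only changes [c] by a boundary, and minus its part of degree
    [a] is the preimage. *)
Lemma hmap_surj j a (x : C k j a) : a != \bot%O ->
  exists2 u : 'rV[k]_(r j.+1), supp_in [set a] u & hmap a u = x.
Proof.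
move=> a0; set c := hrep k (Delta a) j x.
have /cyclesP[Cc bc] : c \in cycles k (Delta a) j := hrep_cycle x.
have [||[t z] [/= Ct Sz] []] := @mcone_acyclic _ (@below_downset _ _ a) j (c, 0).
- by split=> [|v] /=; [rewrite -Delta_cx | rewrite mxE eqxx].
- by case: j x @c Cc bc => //= j x Cc bc; rewrite /mcone_diff_fun /= bc linear0 mul0mx subr0 oppr0.
move=> ec /eqP; rewrite oppr_eq0 => /eqP zM.
have Sz' : supp_in (down a) (z : 'rV_(r j)).
  by move=> v /Sz; apply: subsetP; apply: below_down.
have [y Sy yM] := shift_mx_exact a0 Sz' zM.
have Sg : supp_in [set a] (graded_part a y).
  by move=> v; rewrite mxE inE; case: (deg v =P a) => // _; rewrite eqxx.
exists (- graded_part a y).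
  by move=> v; rewrite mxE oppr_eq0; apply: Sg.
have Sb : supp_in (below a) (y - graded_part a y).
  move=> v; rewrite !mxE inE lt_neqAle; case: ifPn => [_|_]; first by rewrite subrr eqxx.
  by rewrite subr0 => /Sy; rewrite inE.
rewrite linearN /= -[x]hclassK -/c; apply/eqP; rewrite eq_sym -addr_eq0 -linearD /=.
rewrite hclass_eq0; last first.
  by apply: memvD; [apply/cyclesP | apply: cone_map_cycle; apply: supp1_down].
have -> : c + cone_map (graded_part a y *m M j) = bd k P (t - cone_map (y - graded_part a y)).
  rewrite -ec -yM linearB /= bd_cone_map mulmxBl (linearB (@cone_map j)) /=.
  by rewrite opprB addrA addrAC.
by apply/memv_img/memvB; rewrite Delta_cx //; apply: cone_map_chains => //; apply: below_downset.
Qed.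

Lemma hmap0_inj u : hmap0 u = 0 -> u = 0.
Proof.
have [w0 w0P] := r0_unique; move/eqP; rewrite hclass_eq0 (cone_map0 w0).
  case/memv_imgP=> t /mem_chains Ct; have -> : t = 0.
    apply/ffunP=> s; rewrite ffunE; apply/eqP; apply: contraT => /Ct[].
    by rewrite inE => /eqP->; rewrite cards0.
  rewrite linear0 => /ffunP/(_ set0); rewrite !ffunE eqxx /GRing.scale /= mulr1 => u0.
  by apply/rowP=> w; rewrite (w0P w) mxE.
apply/memvZ/cyclesP; rewrite bd_faceE /bd_face big_set0; split=> //.
by apply: face_chains; rewrite ?inE ?cards0.
Qed.

Lemma hmap0_surj (x : C0 k P) : exists u, hmap0 u = x.
Proof.
have [w0 w0P] := r0_unique; set c := hrep k [set set0] 0 x.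
have /cyclesP[/mem_chains Cc _] : c \in cycles k [set set0] 0 := hrep_cycle x.
exists (const_mx (c set0 : k)); rewrite -[RHS]hclassK -/c /hmap0 (cone_map0 w0) mxE.
congr (hclass _ _ _ _); rewrite [RHS]chain_sum_face (bigD1 set0) //= big1 ?addr0 // => t t0.
have [->|/Cc[]] := eqVneq (c t) 0; first by rewrite scale0r.
by rewrite inE (negPf t0).
Qed.

(* The faces of the image of a basis element of positive degree all contain its
   degree, so the restriction to D_l picks out the component at l. *)
Lemma restr_cone_map i a l (y : 'rV[k]_(r i.+1)) : covers l a ->
    (forall v, y 0 v != 0 -> covers (deg v) a) ->
  restr k (Dcx l) (cone_map y) = cone_map (graded_part l y).
Proof.
move=> la yc; rewrite /cone_map linear_sum; apply: eq_bigr => v _; rewrite linearZ mxE /=.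
have [->|/yc va] := eqVneq (y 0 v) 0; first by rewrite if_same !scale0r.
have /mem_chains Cv := cone_basis_chains v.
case: eqP => [e|/eqP ne].
  congr (_ *: _); apply/ffunP=> s; rewrite restrE Dcx_cx -e; case: ifPn => // sl.
  by have [//|/Cv[]] := eqVneq (cone_basis v s) 0; rewrite (negPf sl).
rewrite scale0r; apply/eqP; rewrite scaler_eq0; apply/orP; right; apply/eqP.
apply/ffunP=> s; rewrite restrE [RHS]ffunE Dcx_cx; case: ifPn => // /cxP[_ _ sl _].
apply/eqP; apply: contraT => /cone_mem /sl; rewrite inE => vl.
by rewrite (covers_le_eq va la vl) eqxx in ne.
Qed.

Lemma mulM_covers i a (u : 'rV[k]_(r i.+1)) : supp_in [set a] u ->
  forall w, (u *m M i) 0 w != 0 -> covers (deg w) a.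
Proof.
by move=> ua w /mulM_neq0[v /ua]; rewrite inE => /eqP->.
Qed.

(** Restricting the cycle of [u] to D_l leaves the image of the degree [l] part of its differential,
    and [cone_map] commutes with boundaries. *)
Lemma phi_hmap j a l (u : 'rV[k]_(r j.+2)) : covers l a -> supp_in [set a] u ->
  phi k j a l (hmap a u) = hmap l (graded_part l (u *m M j.+1)).
Proof.
move=> la ua; rewrite /hmap phiE //; last by apply: cone_map_cycle; apply: supp1_down.
by rewrite (restr_cone_map la (mulM_covers ua)) bd_cone_map.
Qed.

Lemma phi1_hmap a (u : 'rV[k]_(r 1)) : supp_in [set a] u ->
  phi1 k a (hmap a u) = hmap0 (u *m M 0).
Proof.
move=> ua; case: (boolP (covers \bot%O a)) => ca.
  by rewrite phi1E //; apply: cone_map_cycle; apply: supp1_down.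
(* [phi1] is zero off the atoms by convention; on the other side, a nonzero entry would make [a]
   cover the least element. *)
rewrite /phi1 (negPf ca) lfunE /=; suff -> : u *m M 0 = 0 by rewrite linear0.
apply/rowP=> w; rewrite [RHS]mxE; apply/eqP; apply: contraT => /(mulM_covers ua).
by rewrite (deg0_bot HM) (negPf ca).
Qed.

End Strand.

(** * Monomial matrices *)

Lemma mcoeffMX_if (k : fieldType) n (p : {mpoly k[n]}) a m :
  (p * 'X_[a])@_m = if (a <= m)%MM then p@_(m - a) else 0.
Proof.
case: ifPn => am; first by rewrite -{1}(submK am) addmC mcoeffMX.
rewrite mcoeffM big1 // => -[m1 m2] /= /eqP e; rewrite mcoeffX.
case: eqP => [e2|]; last by rewrite mulr0.
by rewrite e -e2 lem_addl in am.
Qed.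

Section MonomialMatrices.
Variables (k : fieldType) (n : nat) (disp : Order.disp_t) (P : finBPOrderType disp).
Variable eta : P -> 'X_{1..n}.
Local Notation R := {mpoly k[n]}.
Variables (r : nat -> nat) (deg : forall i, 'I_(r i) -> P).
Variable M : forall i, 'M[k]_(r i.+1, r i).

Hypothesis eta_le : forall x y, (x <= y)%O = (eta x <= eta y)%MM.
Hypothesis eta_bot : eta \bot%O = 0%MM.

Definition monomial_mx i : 'M[R]_(r i.+1, r i) :=
  \matrix_(v, w) (M i v w *: 'X_[eta (deg v) - eta (deg w)]).

Lemma monomial_mxE i v w : monomial_mx i v w = M i v w *: 'X_[eta (deg v) - eta (deg w)].
Proof. exact: mxE. Qed.

(** On vectors supported in [down a], [lift a] homogenizes to multidegree [eta a]; [drop a] reads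
    off the coefficients of the component of that multidegree. *)
Definition lift a i (u : 'rV[k]_(r i)) : 'rV[R]_(r i) :=
  \row_v (u 0 v *: 'X_[eta a - eta (deg v)]).

Definition drop a i (y : 'rV[R]_(r i)) : 'rV[k]_(r i) :=
  \row_v (if (deg v <= a)%O then (y 0 v)@_(eta a - eta (deg v)) else 0).

Lemma eta_subD x y z : (x <= y)%O -> (y <= z)%O ->
  (eta z - eta y + (eta y - eta x) = eta z - eta x)%MM.
Proof.
rewrite !eta_le => /mnm_lepP xy /mnm_lepP yz; apply/mnmP=> i; rewrite !mnmE.
by rewrite addnBA // subnK.
Qed.

Lemma drop_supp a i (y : 'rV[R]_(r i)) : supp_in deg (down a) (drop a y).
Proof. by move=> v; rewrite mxE inE; case: ifP; rewrite ?eqxx. Qed.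

Lemma drop_lift a i (u : 'rV[k]_(r i)) : supp_in deg (down a) u -> drop a (lift a u) = u.
Proof.
move=> ua; apply/rowP=> v; rewrite !mxE mcoeffZ mcoeffX eqxx mulr1.
case: ifPn => // va; apply/esym/eqP; apply: contraNT va => /ua.
by rewrite inE.
Qed.

Hypothesis M_cov : forall i v w, M i v w != 0 -> covers (deg w) (deg v).

Lemma lift_mul a i (u : 'rV[k]_(r i.+1)) : supp_in deg (down a) u ->
  lift a u *m monomial_mx i = lift a (u *m M i).
Proof.
move=> ua; apply/rowP=> w; rewrite !mxE scaler_suml; apply: eq_bigr => v _; rewrite !mxE.
have [->|uv] := eqVneq (u 0 v) 0; first by rewrite mul0r !scale0r mul0r.
have [->|mv] := eqVneq (M i v w) 0; first by rewrite mulr0 !scale0r mulr0.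
rewrite -scalerAl -scalerAr scalerA -mpolyXD eta_subD //; last by have := ua v uv; rewrite inE.
exact/ltW/covers_lt/M_cov.
Qed.

Lemma drop_mul a i (y : 'rV[R]_(r i.+1)) : drop a (y *m monomial_mx i) = drop a y *m M i.
Proof.
apply/rowP=> w; rewrite !mxE; case: ifPn => wa; last first.
  rewrite big1 // => v _; rewrite mxE; case: ifP => va; last by rewrite mul0r.
  have [->|/M_cov/covers_lt/ltW wv] := eqVneq (M i v w) 0; first by rewrite mulr0.
  by rewrite (le_trans wv va) in wa.
rewrite raddf_sum; apply: eq_bigr => v _; rewrite !mxE /=.
have [->|/M_cov/covers_lt/ltW wv] := eqVneq (M i v w) 0.
  by rewrite scale0r !mulr0 mcoeff0.
rewrite -scalerAr mcoeffZ mcoeffMX_if mulrC.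
have -> : (eta (deg v) - eta (deg w) <= eta a - eta (deg w))%MM = (deg v <= a)%O.
  move: wa wv; rewrite !eta_le => /mnm_lepP wa /mnm_lepP wv; apply/mnm_lepP/mnm_lepP => h j.
    by have := h j; rewrite !mnmE leq_sub2rE.
  by rewrite !mnmE leq_sub2r.
case: ifP => // va; congr (_@_ _ * _); rewrite -(eta_subD wv va).
by rewrite addmK.
Qed.

(** Homogenize a vector, use the property over R, and take the component of multidegree [eta a]:
    [drop] commutes with the differentials and inverts [lift]. *)
Lemma strands_of_exact :
    (forall i, monomial_mx i.+1 *m monomial_mx i = 0) ->
    (forall i (u : 'rV[R]_(r i.+1)), u *m monomial_mx i = 0 ->
      exists y, y *m monomial_mx i.+1 = u) ->
    (forall a, a != \bot%O -> forall u : 'rV[k]_(r 0), exists y, y *m monomial_mx 0 = lift a u) ->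
    r 0 = 1%N -> (forall w : 'I_(r 0), deg w = \bot%O) ->
    (forall i (v : 'I_(r i.+1)), deg v != \bot%O) ->
  strands deg M.
Proof.
move=> xMM xex xex0 r0 d0 dS; split=> //.
- move=> i; apply/row_matrixP=> v; rewrite row0 rowE.
  have sv : supp_in deg (down (deg v)) (delta_mx 0 v : 'rV[k]_(r i.+2)).
    move=> w; rewrite mxE eqxx /=; case: (w =P v) => [->|]; last by rewrite eqxx.
    by rewrite inE lexx.
  rewrite mulmxA -[delta_mx 0 v](drop_lift sv) -!drop_mul -mulmxA xMM mulmx0.
  by apply/rowP=> w; rewrite !mxE mcoeff0 if_same.
- move=> a a0 i u ua uM; have [|y yu] := xex i (lift a u).
    rewrite lift_mul // uM; apply/rowP=> w; rewrite !mxE; exact: scale0r.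
  by exists (drop a y); [apply: drop_supp | rewrite -drop_mul yu drop_lift].
move=> a a0 u; have [y yu] := xex0 a a0 u.
exists (drop a y); first exact: drop_supp.
rewrite -drop_mul yu drop_lift // => v _; by rewrite d0 inE le0x.
Qed.

Hypothesis HM : strands deg M.

Let toR m' n' (X : 'M[k]_(m', n')) : 'M[R]_(m', n') := map_mx (@mpolyC n k) X.

(** A scalar matrix acts on each monomial coefficient separately, which reduces injectivity over R
    to injectivity over k. *)
Lemma mcoeff_mul_toR m m' n' (x : 'rV[R]_m') (X : 'M[k]_(m', n')) :
  map_mx (mcoeff m) (x *m toR X) = map_mx (mcoeff m) x *m X.
Proof.
apply/rowP=> j; rewrite !mxE raddf_sum; apply: eq_bigr => i _.
by rewrite !mxE /= mulrC mcoeffCM mulrC.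
Qed.

Definition hmap_mx j (a : P) : 'M[k]_(r j.+1, \dim {:C k j a}) :=
  \matrix_v passmx.rVof (vbasis {:C k j a}) (hmap deg M a (graded_part deg a (delta_mx 0 v))).

Definition hmap0_mx : 'M[k]_(r 0, \dim {:C0 k P}) :=
  \matrix_v passmx.rVof (vbasis {:C0 k P}) (hmap0 deg M (delta_mx 0 v)).

Fact graded_part_linear i a : linear (@graded_part k disp P r deg i a).
Proof.
by move=> x u v; apply/rowP=> w; rewrite !mxE; case: ifP; rewrite ?mulr0 ?addr0.
Qed.
HB.instance Definition _ i a :=
  GRing.isLinear.Build k 'rV[k]_(r i) 'rV[k]_(r i) *:%R (@graded_part k disp P r deg i a)
    (@graded_part_linear i a).

Lemma mul_hmap_mx j a (u : 'rV[k]_(r j.+1)) :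
  u *m hmap_mx j a = passmx.rVof (vbasis {:C k j a}) (hmap deg M a (graded_part deg a u)).
Proof.
rewrite mulmx_sum_row {2}[u]row_sum_delta; do 3 rewrite linear_sum /=.
by apply: eq_bigr => v _; rewrite rowK; do 3 rewrite linearZ /=.
Qed.

Lemma mul_hmap0_mx (u : 'rV[k]_(r 0)) :
  u *m hmap0_mx = passmx.rVof (vbasis {:C0 k P}) (hmap0 deg M u).
Proof.
rewrite mulmx_sum_row {2}[u]row_sum_delta; do 2 rewrite linear_sum /=.
by apply: eq_bigr => v _; rewrite rowK; do 2 rewrite linearZ /=.
Qed.

Lemma hmap_mx_inj j (u : 'rV[k]_(r j.+1)) :
  (forall a, a != \bot%O -> u *m hmap_mx j a = 0) -> u = 0.
Proof.
move=> u0; apply/rowP=> v; have dv := degS_bot HM v.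
have /eqP := u0 _ dv; rewrite mul_hmap_mx rVof_eq0 ?vbasisP // => /eqP /(hmap_inj HM dv) g0.
have /rowP/(_ v) : graded_part deg (deg v) u = 0.
  by apply: g0 => w; rewrite mxE inE; case: (deg w =P deg v) => // _; rewrite eqxx.
by rewrite !mxE eqxx.
Qed.

Lemma hmap0_mx_inj (u : 'rV[k]_(r 0)) : u *m hmap0_mx = 0 -> u = 0.
Proof.
by move/eqP; rewrite mul_hmap0_mx rVof_eq0 ?vbasisP // => /eqP /(hmap0_inj HM).
Qed.

(** The second clause holds because the preimages have degree [a]; it allows the sections for
    different [a] to be added without interference. *)
Lemma hmap_mx_surj j a : a != \bot%O -> exists B : 'M[k]_(\dim {:C k j a}, r j.+1),
  B *m hmap_mx j a = 1%:M /\ forall a', a' != a -> B *m hmap_mx j a' = 0.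
Proof.
move=> a0; have ex_b : forall c : 'I_(\dim {:C k j a}), exists u : 'rV[k]_(r j.+1),
    supp_in deg [set a] u /\ hmap deg M a u = (vbasis {:C k j a})`_c.
  by move=> c; have [u ua uc] := hmap_surj HM ((vbasis {:C k j a})`_c) a0; exists u.
have [b bP] := fin_all_exists ex_b.
exists (\matrix_c b c); split=> [|a' aa'].
  apply/row_matrixP=> c; rewrite row_mul rowK row1 mul_hmap_mx; have [bc ec] := bP c.
  rewrite -(rVofE (vbasisP _)) -ec; congr (rVof _ (hmap _ _ _ _)).
  apply/rowP=> v; rewrite mxE; case: ifPn => // va; apply/esym/eqP; apply: contraNT va => /bc.
  by rewrite inE.
apply/row_matrixP=> c; rewrite row_mul rowK row0 mul_hmap_mx; have [bc _] := bP c.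
suff -> : graded_part deg a' (b c) = 0 by rewrite !linear0.
apply/rowP=> v; rewrite !mxE; case: ifPn => // /eqP va; apply/eqP; apply: contraNT aa' => /bc.
by rewrite inE va.
Qed.

Lemma hmap0_mx_surj : exists B : 'M[k]_(\dim {:C0 k P}, r 0), B *m hmap0_mx = 1%:M.
Proof.
have ex_b : forall c : 'I_(\dim {:C0 k P}), exists u : 'rV[k]_(r 0),
    hmap0 deg M u = (vbasis {:C0 k P})`_c by move=> c; apply: (hmap0_surj HM).
have [b bP] := fin_all_exists ex_b.
exists (\matrix_c b c); apply/row_matrixP=> c.
by rewrite row_mul rowK row1 mul_hmap0_mx bP rVofE // vbasisP.
Qed.

Lemma mcoeff_row_inj m' (x : 'rV[R]_m') : (forall m, map_mx (mcoeff m) x = 0) -> x = 0.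
Proof.
move=> x0; apply/rowP=> c; rewrite mxE; apply/mpolyP => m.
by have /rowP/(_ c) := x0 m; rewrite !mxE mcoeff0.
Qed.

Local Notation P' := {l : P | l != \bot%O}.

(** No powers of the variables appear: a basis element of degree [a] goes to the summand of [a],
    whose generators have the same multidegree. *)
Definition Feta_iso i : 'rV[R]_(r i) -> Feta k eta i :=
  match i return 'rV[R]_(r i) -> Feta k eta i with
  | 0 => fun x => (x *m toR hmap0_mx : bchange n (C0 k P))
  | j.+1 => fun x =>
      ([ffun l : P' => (x *m toR (hmap_mx j (val l)) : bchange n (C k j (val l)))]
        : Feta_sum k n P j)
  end.

Lemma Feta_iso0 i : Feta_iso (0 : 'rV[R]_(r i)) = 0.
Proof.
case: i => [|j] /=; first exact: mul0mx.
by apply/ffunP=> l; rewrite !ffunE mul0mx.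
Qed.

Lemma Feta_iso_inj i : injective (@Feta_iso i).
Proof.
case: i => [|j] x y.
  move=> /= /eqP; rewrite -subr_eq0 -mulmxBl => /eqP xy; apply/eqP; rewrite -subr_eq0; apply/eqP.
  apply: mcoeff_row_inj => m; apply: hmap0_mx_inj; rewrite -mcoeff_mul_toR xy.
  by apply/rowP=> c; rewrite !mxE mcoeff0.
move=> /= /ffunP xy; apply/eqP; rewrite -subr_eq0; apply/eqP.
apply: mcoeff_row_inj => m; apply: hmap_mx_inj => a a0; rewrite -mcoeff_mul_toR.
have := xy (Sub a a0); rewrite !ffunE /= => /eqP; rewrite -subr_eq0 -mulmxBl => /eqP ->.
by apply/rowP=> c; rewrite !mxE mcoeff0.
Qed.

Lemma toR_mul m1 m2 m3 (X : 'M[k]_(m1, m2)) (Y : 'M[k]_(m2, m3)) :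
  toR X *m toR Y = toR (X *m Y).
Proof. by rewrite /toR map_mxM. Qed.

Lemma Feta_iso_surj i (z : Feta k eta i) : exists x, Feta_iso x = z.
Proof.
case: i z => [|j] z.
  have [B B1] := hmap0_mx_surj; exists ((z : 'rV[R]_(_)) *m toR B) => /=.
  by rewrite -mulmxA toR_mul B1 /toR map_mx1 mulmx1.
have ex_B : forall l : P', exists B : 'M[k]_(\dim {:C k j (val l)}, r j.+1),
    B *m hmap_mx j (val l) = 1%:M /\ forall a', a' != val l -> B *m hmap_mx j a' = 0.
  by move=> l; apply/hmap_mx_surj/(valP l).
have [B BP] := fin_all_exists ex_B.
exists (\sum_l ((z : Feta_sum k n P j) l : 'rV[R]_(_)) *m toR (B l)) => /=.
apply/ffunP=> l; rewrite ffunE mulmx_suml (bigD1 l) //= big1 ?addr0 => [|l' l'l].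
  by rewrite -mulmxA toR_mul (BP l).1 /toR map_mx1 mulmx1.
by rewrite -mulmxA toR_mul (BP l').2 ?[toR 0]map_mx0 ?mulmx0 // eq_sym.
Qed.

Lemma delta_supp i (v : 'I_(r i)) : supp_in deg [set deg v] (delta_mx 0 v : 'rV[k]_(r i)).
Proof.
by move=> w; rewrite mxE eqxx inE /=; case: (w =P v) => [->|]; rewrite eqxx.
Qed.

Lemma graded_part_delta i a (v : 'I_(r i)) :
  graded_part deg a (delta_mx 0 v : 'rV[k]_(r i)) = if deg v == a then delta_mx 0 v else 0.
Proof.
apply/rowP=> w; rewrite !mxE eqxx /=.
case: (w =P v) => [->|wv]; first by case: ifP; rewrite mxE ?eqxx.
by rewrite if_same; case: ifP; rewrite mxE // (introF eqP wv) andbF.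
Qed.

Lemma row_hmap_mx_phi1 (v : 'I_(r 1)) l :
  row v (hmap_mx 0 l *m mxof (vbasis {:C k 0 l}) (vbasis {:C0 k P}) (phi1 k l)) =
  if deg v == l then row v (M 0 *m hmap0_mx) else 0.
Proof.
rewrite row_mul rowK -(rVof_app _ (vbasisP _)) graded_part_delta.
case: eqP => [<-|_]; last by rewrite !linear0.
by rewrite (phi1_hmap HM) ?rowE -?mul_hmap0_mx ?mulmxA //; apply: delta_supp.
Qed.

Lemma row_hmap_mx_phi j (v : 'I_(r j.+2)) a l : covers l a ->
  row v (hmap_mx j.+1 a *m mxof (vbasis {:C k j.+1 a}) (vbasis {:C k j l}) (phi k j a l)) =
  if deg v == a then row v (M j.+1 *m hmap_mx j l) else 0.
Proof.
move=> la; rewrite row_mul rowK -(rVof_app _ (vbasisP _)) graded_part_delta.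
case: eqP => [va|_]; last by rewrite !linear0.
rewrite (phi_hmap HM) -?va //; last by apply: delta_supp.
  by rewrite rowE mulmxA mul_hmap_mx.
by rewrite va.
Qed.

Lemma hmap_mx_supp j l (w : 'I_(r j.+1)) c : hmap_mx j l w c != 0 -> deg w = l.
Proof.
have -> : hmap_mx j l w c = row w (hmap_mx j l) 0 c by rewrite [RHS]mxE.
apply: contraNeq => /negPf wl.
by rewrite rowK graded_part_delta wl !linear0 mxE.
Qed.

Lemma scale_toRE m' n' p (X : 'M[k]_(m', n')) v c : (p *: toR X) v c = p * (X v c)%:MP.
Proof. by rewrite !mxE. Qed.

Lemma mul_toRE m1 m' n' (A : 'M[R]_(m1, m')) (X : 'M[k]_(m', n')) v c :
  (A *m toR X) v c = \sum_w A v w * (X w c)%:MP.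
Proof. by rewrite !mxE; apply: eq_bigr => w _; rewrite mxE. Qed.

Lemma row_entry m' n' (X : 'M[k]_(m', n')) v u c : row v X = u -> X v c = u 0 c.
Proof. by move=> <-; rewrite mxE. Qed.

Lemma monomial_mx_hmap0_mx : monomial_mx 0 *m toR hmap0_mx = \sum_(l : P') 'X_[eta (val l)] *:
  toR (hmap_mx 0 (val l) *m mxof (vbasis {:C k 0 (val l)}) (vbasis {:C0 k P}) (phi1 k (val l))).
Proof.
apply/matrixP=> v c; rewrite summxE (bigD1 (Sub (deg v) (degS_bot HM v))) //= big1 => [|l lv].
    rewrite addr0 scale_toRE (row_entry _ (row_hmap_mx_phi1 v (deg v))) eqxx.
  rewrite [row _ _ _ _]mxE mul_toRE.
  rewrite mxE rmorph_sum mulr_sumr; apply: eq_bigr => w _.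
  rewrite monomial_mxE (deg0_bot HM) eta_bot /= rmorphM -mul_mpolyC mulrA; congr (_ * _).
  by rewrite mulrC; congr (_ * _); congr 'X_[_]; apply/mnmP=> t; rewrite !mnmE subn0.
rewrite scale_toRE (row_entry _ (row_hmap_mx_phi1 v (val l))) ifN ?mxE ?rmorph0 ?mulr0 //.
by apply: contraNneq lv => vl; apply/eqP/val_inj.
Qed.

(** In row [v] both sides are the same monomial times a scalar row: on the left only columns of
    degree [l] survive, so the monomial factors out; on the right only the summand of [deg v]
    survives. Both vanish unless [deg v] covers [l]. *)
Lemma monomial_mx_hmap_mx j l : monomial_mx j.+1 *m toR (hmap_mx j l) =
  \sum_(a : P' | covers l (val a)) 'X_[eta (val a) - eta l] *:
    toR (hmap_mx j.+1 (val a) *m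
      mxof (vbasis {:C k j.+1 (val a)}) (vbasis {:C k j l}) (phi k j (val a) l)).
Proof.
apply/matrixP=> v c; transitivity ('X_[eta (deg v) - eta l] * ((M j.+1 *m hmap_mx j l) v c)%:MP).
  rewrite mul_toRE mxE rmorph_sum mulr_sumr; apply: eq_bigr => w _; rewrite monomial_mxE.
  have [->|/hmap_mx_supp wl] := eqVneq (hmap_mx j l w c) 0.
    by rewrite ?(mulr0, raddf0, mpolyC0).
  by rewrite wl rmorphM -mul_mpolyC mulrA; congr (_ * _); rewrite mulrC.
have [lv|lv] := boolP (covers l (deg v)); last first.
  rewrite summxE big1 => [|a la].
    rewrite mxE big1 ?rmorph0 ?mulr0 // => w _; apply/eqP; apply: contraNT lv.
    by rewrite mulf_eq0 negb_or => /andP[/M_cov h /hmap_mx_supp <-].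
  rewrite scale_toRE (row_entry _ (row_hmap_mx_phi v la)) ifN ?mxE ?rmorph0 ?mulr0 //.
  by apply: contraNneq lv => ->.
rewrite summxE (bigD1 (Sub (deg v) (degS_bot HM v))) //= big1 => [|a /andP[la av]].
  by rewrite addr0 scale_toRE (row_entry _ (row_hmap_mx_phi v lv)) eqxx [in RHS]mxE.
rewrite scale_toRE (row_entry _ (row_hmap_mx_phi v la)) ifN ?mxE ?rmorph0 ?mulr0 //.
by apply: contraNneq av => va; apply/eqP/val_inj.
Qed.

Lemma Feta_iso_diff i (x : 'rV[R]_(r i.+1)) :
  mg_diff (Feta k eta) i (Feta_iso x) = Feta_iso (x *m monomial_mx i).
Proof.
case: i x => [|j] x /=.
  rewrite /Feta_diff1 -mulmxA monomial_mx_hmap0_mx mulmx_sumr; apply: eq_bigr => l _.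
  by rewrite ffunE /bchange_map -scalemxAr -mulmxA toR_mul.
apply/ffunP=> l; rewrite !ffunE -mulmxA monomial_mx_hmap_mx mulmx_sumr; apply: eq_bigr => a _.
by rewrite ffunE /bchange_map -scalemxAr -mulmxA toR_mul.
Qed.

End MonomialMatrices.

(** * Homogeneous elements and graded bases *)

Section HomogeneousPart.
Variables (k : fieldType) (n : nat).
Local Notation R := {mpoly k[n]}.
Implicit Types (p q : R) (d e : 'rV[int]_n) (m a : 'X_{1..n}).

Lemma mdegZ_inj : injective (@mdegZ n).
Proof.
by move=> m m' /rowP h; apply/mnmP=> i; have := h i; rewrite !mxE => -[].
Qed.

Lemma mdegZD m m' : mdegZ (m + m')%MM = mdegZ m + mdegZ m'.
Proof. by apply/rowP=> i; rewrite !mxE mnmDE PoszD. Qed.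

Lemma mdegZ0 : mdegZ (0%MM : 'X_{1..n}) = 0.
Proof. by apply/rowP=> i; rewrite !mxE mnm0E. Qed.

Lemma mdegZB m a : (a <= m)%MM -> mdegZ (m - a)%MM = mdegZ m - mdegZ a.
Proof. by move=> am; rewrite -{2}(submK am) mdegZD addrK. Qed.

Lemma poly_compP d p : poly_comp d p <-> forall m, p@_m != 0 -> mdegZ m = d.
Proof. by split=> h m; have := h m; rewrite mcoeff_msupp. Qed.

Lemma poly_comp0 d : poly_comp d (0 : R).
Proof. by apply/poly_compP => m; rewrite mcoeff0 eqxx. Qed.

Lemma poly_compD d p q : poly_comp d p -> poly_comp d q -> poly_comp d (p + q).
Proof.
move=> /poly_compP hp /poly_compP hq; apply/poly_compP => m; rewrite mcoeffD => pq.
have [p0|/hp//] := eqVneq p@_m 0; apply: hq.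
by move: pq; rewrite p0 add0r.
Qed.

Lemma poly_comp_sum (I : finType) d (f : I -> R) :
  (forall i, poly_comp d (f i)) -> poly_comp d (\sum_i f i).
Proof.
by move=> hf; apply: big_ind => [|p q|i _]; [apply: poly_comp0 | apply: poly_compD | apply: hf].
Qed.

Lemma poly_compM d e p q : poly_comp d p -> poly_comp e q -> poly_comp (d + e) (p * q).
Proof.
move=> hp hq m /msuppM_le /allpairsP[[m1 m2] /= [/hp <- /hq <- ->]].
exact: mdegZD.
Qed.

Lemma poly_compX m : poly_comp (mdegZ m) ('X_[m] : R).
Proof. by move=> m'; rewrite msuppX inE => /eqP->. Qed.

Lemma poly_compC c : poly_comp 0 (c%:MP : R).
Proof.
apply/poly_compP => m; rewrite mcoeffC; case: (m =P 0%MM) => [->|_]; first by rewrite mdegZ0.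
by rewrite mulr0 eqxx.
Qed.

Lemma poly_comp_monomial m p : poly_comp (mdegZ m) p -> p = p@_m *: 'X_[m].
Proof.
move=> /poly_compP hp; apply/mpolyP => m'; rewrite mcoeffZ mcoeffX.
case: (m =P m') => [->|mm']; first by rewrite mulr1.
rewrite mulr0; apply/eqP; apply: contraT => /hp /mdegZ_inj e.
by rewrite e in mm'.
Qed.

Definition hpart d p : R := \sum_(m <- msupp p | mdegZ m == d) p@_m *: 'X_[m].

Lemma mcoeff_hpart d p m : (hpart d p)@_m = if mdegZ m == d then p@_m else 0.
Proof.
rewrite /hpart raddf_sum /=.
under eq_bigr => m' _ do rewrite mcoeffZ mcoeffX.
have [mp|mp] := boolP (m \in msupp p); last first.
  rewrite (memN_msupp_eq0 mp) if_same big_seq_cond big1 // => m' /andP[m'p _].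
  by case: (m' =P m) => [e|]; [rewrite e (negPf mp) in m'p | rewrite mulr0].
rewrite big_mkcond (bigD1_seq m) ?msupp_uniq //= eqxx mulr1 big1 ?addr0 // => m' /negPf m'm.
by rewrite m'm mulr0 if_same.
Qed.

Lemma hpart_comp d p : poly_comp d (hpart d p).
Proof.
by apply/poly_compP => m; rewrite mcoeff_hpart; case: (mdegZ m =P d) => //; rewrite eqxx.
Qed.

Lemma hpart_id d p : poly_comp d p -> hpart d p = p.
Proof.
move=> /poly_compP hp; apply/mpolyP => m; rewrite mcoeff_hpart; case: ifPn => // /eqP md.
by apply/esym/eqP; apply: contraT => /hp.
Qed.

Lemma hpart_sum I (s : seq I) d (f : I -> R) :
  hpart d (\sum_(i <- s) f i) = \sum_(i <- s) hpart d (f i).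
Proof.
apply/mpolyP => m; rewrite mcoeff_hpart !raddf_sum /=.
under [RHS]eq_bigr => i _ do rewrite mcoeff_hpart.
by case: ifP => // _; rewrite big1.
Qed.

Lemma hpartM d e p q : poly_comp e q -> hpart (d + e) (p * q) = hpart d p * q.
Proof.
move=> hq; have [->|q0] := eqVneq q 0.
  by rewrite !mulr0 hpart_id //; apply: poly_comp0.
have [a aq] : exists a, a \in msupp q.
  case E: (msupp q) => [|a s]; last by exists a; rewrite inE eqxx.
  by rewrite -msupp_eq0 E in q0.
have ae := hq a aq; rewrite -ae in hq *; rewrite (poly_comp_monomial hq).
apply/mpolyP => m; rewrite mcoeff_hpart -!scalerAr !mcoeffZ !mcoeffMX_if.
case: (boolP (a <= m)%MM) => am; last by rewrite mulr0 if_same.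
by rewrite mcoeff_hpart mdegZB // subr_eq; case: ifP; rewrite ?mulr0.
Qed.

End HomogeneousPart.

(** * Coordinates in a multihomogeneous basis *)

Section Bases.
Variables (k : fieldType) (n : nat).
Local Notation R := {mpoly k[n]}.

Lemma basis_inj (M : lmodType R) r (b : 'I_r -> M) (c c' : 'rV[R]_r) : is_basis b ->
  \sum_i c 0 i *: b i = \sum_i c' 0 i *: b i -> c = c'.
Proof.
move=> hb e; have [c0 [_ u]] := hb (\sum_i c 0 i *: b i).
by rewrite -(u c) // -(u c').
Qed.

(** The grading is defined by some basis [b'], not by [b]. Expanding [b] in [b'] shows that
    replacing each coordinate of [x] by its homogeneous part of the expected degree does not change
    [x], and coordinates in [b] are unique. *)
Lemma comp_coords (M : mgmodule k n) r (b : 'I_r -> M) e d x (c : 'rV[R]_r) :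
    mgfree M -> mhbasis b e -> mg_comp d x -> x = \sum_i c 0 i *: b i ->
  forall i, poly_comp (d - e i) (c 0 i).
Proof.
move=> [r' [b' [e' [hb' gr']]]] [hb gb] /gr'[h xh hh] xc.
have ex_a : forall i, exists a : 'rV[R]_r', b i = \sum_j a 0 j *: b' j /\
    forall j, poly_comp (e i - e' j) (a 0 j).
  by move=> i; have /gr'[a ba ha] := gb i; exists a.
have [a aP] := fin_all_exists ex_a.
have sumE (u : 'rV[R]_r) :
    \sum_i u 0 i *: b i = \sum_j (\row_j' \sum_i u 0 i * a i 0 j') 0 j *: b' j.
  under eq_bigr => i _ do rewrite (aP i).1 scaler_sumr.
  rewrite exchange_big; apply: eq_bigr => j _; rewrite mxE scaler_suml.
  by apply: eq_bigr => i _; rewrite scalerA.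
have /rowP hE : h = \row_j \sum_i c 0 i * a i 0 j.
  by apply: (basis_inj hb'); rewrite -sumE -xc.
have /rowP cE : c = \row_i hpart (d - e i) (c 0 i).
  apply: (basis_inj hb); rewrite -xc xh sumE; apply: eq_bigr => j _; congr (_ *: _).
  rewrite -(hpart_id (hh j)) hE !mxE hpart_sum; apply: eq_bigr => i _; rewrite mxE.
  by rewrite -(hpartM _ _ ((aP i).2 j)) addrA subrK.
by move=> i; rewrite cE mxE; apply: hpart_comp.
Qed.

Lemma comp_combination (M : mgmodule k n) r (b : 'I_r -> M) e d (c : 'rV[R]_r) :
    mgfree M -> mhbasis b e -> (forall i, poly_comp (d - e i) (c 0 i)) ->
  mg_comp d (\sum_i c 0 i *: b i).
Proof.
move=> [r' [b' [e' [hb' gr']]]] [hb gb] hc.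
have ex_a : forall i, exists a : 'rV[R]_r', b i = \sum_j a 0 j *: b' j /\
    forall j, poly_comp (e i - e' j) (a 0 j).
  by move=> i; have /gr'[a ba ha] := gb i; exists a.
have [a aP] := fin_all_exists ex_a.
apply/gr'; exists (\row_j \sum_i c 0 i * a i 0 j) => [|j].
  under eq_bigr => i _ do rewrite (aP i).1 scaler_sumr.
  rewrite exchange_big; apply: eq_bigr => j _; rewrite mxE scaler_suml.
  by apply: eq_bigr => i _; rewrite scalerA.
rewrite mxE; apply: poly_comp_sum => i.
by have := poly_compM (hc i) ((aP i).2 j); rewrite addrA subrK.
Qed.

Definition bcoord (M : lmodType R) r (b : 'I_r -> M) (hb : is_basis b) (x : M) : 'rV[R]_r :=
  proj1_sig (constructive_indefinite_description _ (hb x)).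

Lemma bcoordE (M : lmodType R) r (b : 'I_r -> M) (hb : is_basis b) (x : M) :
  x = \sum_i bcoord hb x 0 i *: b i.
Proof. by rewrite /bcoord; case: constructive_indefinite_description => c []. Qed.

Lemma maxideal_coords (M : lmodType R) r (b : 'I_r -> M) (c : 'rV[R]_r) : is_basis b ->
  in_maxideal (\sum_i c 0 i *: b i) -> forall i, (c 0 i)@_0%MM = 0.
Proof.
move=> hb [y cy] i; have /rowP -> : c = \sum_j 'X_j *: bcoord hb (y j).
  apply: (basis_inj hb); rewrite cy.
  under [RHS]eq_bigr => l _ do rewrite summxE scaler_suml.
  rewrite exchange_big; apply: eq_bigr => j _.
  rewrite {1}(bcoordE hb (y j)) scaler_sumr; apply: eq_bigr => l _.
  by rewrite mxE scalerA.
rewrite summxE raddf_sum big1 // => j _ /=.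
rewrite mxE mulrC mcoeffMX_if; case: ifP => // /mnm_lepP /(_ j).
by rewrite mnm1E eqxx mnm0E.
Qed.

End Bases.

(** * The resolution of a lattice-linear ideal *)

Section MnmLcm.
Variable n : nat.

Fact mlcmA : associative (@mlcm n).
Proof. by move=> m1 m2 m3; apply/mnmP=> i; rewrite !mnmE maxnA. Qed.
HB.instance Definition _ :=
  Monoid.isComLaw.Build 'X_{1..n} 0%MM (@mlcm n) mlcmA (@mlcmC n) (@mlc0m n).

End MnmLcm.

Section MonomialIdeals.
Variables (k : fieldType) (n : nat).
Local Notation R := {mpoly k[n]}.
Variable N : idealr R.

Lemma pi_eq0 (p : R) : (\pi_{ideal_quot N}%qT p == 0) = (p \in N).
Proof. by rewrite -[in RHS](subr0 p) Quotient.idealrBE rmorph0. Qed.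

Lemma lcm_deg_bot : lcm_deg (\bot%O : lcm_lattice N) = 0%MM.
Proof. by []. Qed.

Lemma lcm_deg_in (a : lcm_lattice N) : a != \bot%O -> 'X_[lcm_deg a] \in N.
Proof.
move=> a0; have /imageP[A _ aA] : lcm_deg a \in lcms N by exact: ssvalP.
have [A0|[g gA]] := set_0Vmem A.
  case/eqP: a0; apply: val_inj; rewrite -[val a]/(lcm_deg a) aA A0 big_set0.
  exact: esym lcm_deg_bot.
have /(min_gensP N) [Ng _] := ssvalP g.
have ga : (ssval g <= lcm_deg a)%MM by rewrite aA (bigD1 g) //= lem_mlcml.
by rewrite -(submK ga) mpolyXD idealMr.
Qed.

(** A constant term could only come from the generator 1, which a proper ideal excludes. *)
Lemma monomial_ideal_coeff0 (p : R) : monomial_ideal N -> p \in N -> p@_0%MM = 0.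
Proof.
move=> [S SP] /SP[r [c [m [Sm ->]]]]; rewrite raddf_sum big1 // => i _ /=.
rewrite mcoeffMX_if; case: ifPn => // /mnm_lepP mi; have m0 : m i = 0%MM.
  by apply/mnmP=> j; have := mi j; rewrite mnm0E leqn0 => /eqP.
have : 1 \in N; last by rewrite idealr1.
apply/SP; exists 1%N, (fun=> 1), (fun=> m i); split=> //.
by rewrite big_ord_recl big_ord0 addr0 mul1r m0 mpolyX0.
Qed.

End MonomialIdeals.

Section LatticeLinear.
Variables (k : fieldType) (n : nat).
Local Notation R := {mpoly k[n]}.
Variables (N : idealr R) (F : mgsequence k n).
Local Notation L := (lcm_lattice N).
Variables (r : nat -> nat) (b : forall i, 'I_(r i) -> F i) (e : forall i, 'I_(r i) -> 'rV[int]_n).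

Hypothesis hN : monomial_ideal N.
Hypothesis HF : minimal_free_resolution N F.
Hypothesis mh : forall i, mhbasis (@b i) (@e i).
Hypothesis cov : forall i (v : 'I_(r i.+1)) (c : 'rV[R]_(r i)),
  mg_diff F i (@b i.+1 v) = \sum_w c 0 w *: @b i w ->
  forall w, c 0 w != 0 ->
    exists l a : L, [/\ e w = mdegZ (lcm_deg l), e v = mdegZ (lcm_deg a) & covers l a].

Let hb i : is_basis (@b i) := (mh i).1.

Definition lincomb i (x : 'rV[R]_(r i)) : F i := \sum_w x 0 w *: @b i w.

Definition diff_mx i : 'M[R]_(r i.+1, r i) :=
  \matrix_v bcoord (@hb i) (mg_diff F i (@b i.+1 v)).

Lemma lincomb_inj i : injective (@lincomb i).
Proof. by move=> x y; apply: basis_inj. Qed.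

Lemma lincomb_surj i (y : F i) : exists x, lincomb x = y.
Proof. by exists (bcoord (@hb i) y); rewrite [RHS](bcoordE (@hb i)). Qed.

Lemma diff_basis i v : mg_diff F i (@b i.+1 v) = \sum_w diff_mx i v w *: @b i w.
Proof. by rewrite {1}(bcoordE (@hb i) (mg_diff F i (b v))); apply: eq_bigr => w _; rewrite mxE. Qed.

Lemma diff_lincomb i (x : 'rV[R]_(r i.+1)) : mg_diff F i (lincomb x) = lincomb (x *m diff_mx i).
Proof.
rewrite /lincomb linear_sum /=; under [RHS]eq_bigr => w _ do rewrite mxE scaler_suml.
rewrite exchange_big; apply: eq_bigr => v _.
rewrite linearZ /= diff_basis scaler_sumr; apply: eq_bigr => w _.
by rewrite scalerA.
Qed.

Lemma lincomb0 i : lincomb (0 : 'rV[R]_(r i)) = 0.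
Proof. by rewrite /lincomb big1 // => w _; rewrite mxE scale0r. Qed.

Lemma lincombD i (x y : 'rV[R]_(r i)) : lincomb (x + y) = lincomb x + lincomb y.
Proof. by rewrite /lincomb -big_split; apply: eq_bigr => w _; rewrite mxE scalerDl. Qed.

Lemma lincombZ i p (x : 'rV[R]_(r i)) : lincomb (p *: x) = p *: lincomb x.
Proof. by rewrite /lincomb scaler_sumr; apply: eq_bigr => w _; rewrite mxE scalerA. Qed.

Lemma diff_mx_complex i : diff_mx i.+1 *m diff_mx i = 0.
Proof.
apply/row_matrixP=> v; rewrite row0 rowE mulmxA; apply: lincomb_inj.
by rewrite -!diff_lincomb (mfr_complex HF) lincomb0.
Qed.

Lemma diff_mx_exact i (u : 'rV[R]_(r i.+1)) : u *m diff_mx i = 0 -> exists y, y *m diff_mx i.+1 = u.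
Proof.
move=> u0; have [|y yu] := mfr_exact HF (i := i) (x := lincomb u).
  by rewrite diff_lincomb u0 lincomb0.
have [x xy] := lincomb_surj y; exists x; apply: lincomb_inj.
by rewrite -diff_lincomb xy.
Qed.

Lemma diff_mx_homog i v w : poly_comp (e v - e w) (diff_mx i v w).
Proof.
have h := comp_coords (mfr_free HF i) (mh i) (mfr_homog HF ((mh i.+1).2 v))
  (bcoordE (@hb i) _).
by rewrite mxE; apply: h.
Qed.

Lemma diff_mx_cov i v w : diff_mx i v w != 0 ->
  exists l a : L, [/\ e w = mdegZ (lcm_deg l), e v = mdegZ (lcm_deg a) & covers l a].
Proof.
move=> Avw; have dE : mg_diff F i (@b i.+1 v) = \sum_w (row v (diff_mx i)) 0 w *: @b i w.
  by rewrite diff_basis; apply: eq_bigr => w' _; rewrite [row _ _ _ _]mxE.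
by apply: (cov dE); rewrite [row _ _ _ _]mxE.
Qed.

Lemma diff_maxideal_coeff0 i (x : 'rV[R]_(r i.+1)) w : ((x *m diff_mx i) 0 w)@_0%MM = 0.
Proof.
have := mfr_minimal HF (lincomb x); rewrite diff_lincomb => h; exact: (maxideal_coords (@hb i) h).
Qed.

(** Otherwise the basis element would be a cycle, hence a boundary, although its coefficient 1 does
    not lie in the maximal ideal. Some entry is therefore subject to the covering condition, which
    places the degree of [v] in the lattice. *)
Lemma diff_mx_neq0 i v : exists w, diff_mx i v w != 0.
Proof.
apply/existsP; apply: contraT; rewrite negb_exists => /forallP A0.
have [|y yv] := @diff_mx_exact i (delta_mx 0 v).
  apply/rowP=> w; rewrite -rowE !mxE; apply/eqP.
  by have := A0 w; rewrite negbK => /eqP; rewrite mxE => ->.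
have := diff_maxideal_coeff0 y v.
by rewrite yv mxE !eqxx mcoeff1 eqxx => /eqP; rewrite oner_eq0.
Qed.

(** Lifting 1 along the augmentation yields a basis element whose image has a nonzero constant term,
    as N contains no such polynomial; by homogeneity its degree is 0 and its image a nonzero scalar.
    Minimality then excludes a second basis element. *)
Lemma first_basis : exists w0 : 'I_(r 0), [/\ forall w, w = w0, e w0 = 0 &
  forall y : 'rV[R]_(r 0), y 0 w0 \in N <-> exists x, x *m diff_mx 0 = y].
Proof.
have [eps [epsD epsZ eps_surj eps_ker eps_deg]] := mfr_coker HF.
have eps0 : eps 0 = 0 by apply/eps_ker; exists 0; rewrite linear0.
have eps_lincomb (x : 'rV[R]_(r 0)) (q : 'I_(r 0) -> R) :
    (forall w, eps (@b 0 w) = \pi_{ideal_quot N}%qT (q w)) ->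
    eps (lincomb x) = \pi_{ideal_quot N}%qT (\sum_w x 0 w * q w).
  move=> qE; rewrite rmorph_sum /lincomb /=.
  rewrite (big_morph eps (id1 := 0) (op1 := +%R)) //; apply: eq_bigr => w _.
  by rewrite epsZ qE rmorphM.
have ex_q : forall w : 'I_(r 0), exists q, poly_comp (e w) q /\
    eps (@b 0 w) = \pi_{ideal_quot N}%qT q.
  by move=> w; have [q] := eps_deg _ _ ((mh 0).2 w); exists q.
have [q qP] := fin_all_exists ex_q.
have [y y1] := eps_surj (\pi_{ideal_quot N}%qT 1); have [x xy] := lincomb_surj y.
move: y1; rewrite -xy (eps_lincomb _ q) => [/eqP|w]; last by case: (qP w).
rewrite -subr_eq0 -rmorphB pi_eq0 => /(monomial_ideal_coeff0 hN) /eqP.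
rewrite mcoeffB mcoeff1 eqxx subr_eq0 raddf_sum /= => s1.
have [w0 qw0] : exists w0, (q w0)@_0%MM != 0.
  apply/existsP; apply: contraTT s1; rewrite negb_exists => /forallP q0.
  rewrite big1 ?(eq_sym 0) ?oner_eq0 // => w _; have := q0 w; rewrite negbK => /eqP q0w.
  by rewrite rmorphM /= [X in _ * X]q0w mulr0.
have ew0 : e w0 = 0.
  by have [/poly_compP /(_ _ qw0) <- _] := qP w0; rewrite mdegZ0.
have [q_comp eps_b] := qP w0; rewrite ew0 -mdegZ0 in q_comp.
set c := (q w0)@_0%MM in qw0; have qE : q w0 = c%:MP.
  by rewrite (poly_comp_monomial q_comp) mpolyX0 alg_mpolyC.
have ker (z : 'rV[R]_(r 0)) : eps (lincomb z) = 0 <-> exists x, x *m diff_mx 0 = z.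
  split=> [/eps_ker[t tz]|[t <-]].
    by have [t' t't] := lincomb_surj t; exists t'; apply: lincomb_inj; rewrite -diff_lincomb t't.
  by apply/eps_ker; exists (lincomb t); rewrite diff_lincomb.
have w0P w : w = w0.
  apply/eqP; apply: contraT => ww0.
  (* Subtracting the multiple of generator [w0] with the same image gives a boundary whose
     coordinate at [w] is 1, against minimality. *)
  have /ker[t tE] : eps (lincomb (delta_mx 0 w - (c^-1 *: q w) *: delta_mx 0 w0)) = 0.
    rewrite (eps_lincomb _ q) => [|w']; last by case: (qP w').
    rewrite (bigD1 w) //= (bigD1 w0) 1?eq_sym //= big1 => [|w' /andP[/negPf w'w /negPf w'0]].
      rewrite !mxE !eqxx (negPf ww0) eq_sym (negPf ww0) /= mulr0 subr0 mul1r mulr1 sub0r addr0.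
      rewrite qE mulNr -scalerAl -[q w * _]mulrC mul_mpolyC scalerA mulVf // scale1r.
      by rewrite subrr rmorph0.
    by rewrite !mxE w'w w'0 !andbF mulr0 subr0 mul0r.
  have := diff_maxideal_coeff0 t w; rewrite tE !mxE !eqxx (negPf ww0) /= mulr0 subr0.
  by rewrite mcoeff1 eqxx => /eqP; rewrite oner_eq0.
exists w0; split=> // z; split=> [zN|/ker].
  apply/ker/eqP; rewrite (eps_lincomb _ q) => [|w']; last by case: (qP w').
  rewrite pi_eq0 (bigD1 w0) //= big1 ?addr0 => [|w]; last by rewrite (w0P w) eqxx.
  by rewrite mulrC idealMr.
move/eqP; rewrite (eps_lincomb _ q) => [|w']; last by case: (qP w').
rewrite pi_eq0 (bigD1 w0) //= big1 ?addr0 => [|w]; last by rewrite (w0P w) eqxx.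
move/(idealMr (c^-1)%:MP); rewrite qE mulrCA -mpolyCM mulVf //.
by rewrite mpolyC1 mulr1.
Qed.

(** The default value is never taken: in position 0 the only degree is 0, and afterwards a nonzero
    entry of the differential provides a lattice element. *)
Definition deg i (w : 'I_(r i)) : L := odflt \bot%O [pick l : L | e w == mdegZ (lcm_deg l)].

Lemma deg_of i (w : 'I_(r i)) (l : L) : e w = mdegZ (lcm_deg l) -> deg w = l.
Proof.
rewrite /deg => ew; case: pickP => [l' /= /eqP|/(_ l)]; last by rewrite ew eqxx.
by rewrite ew => /mdegZ_inj h; apply/val_inj/esym.
Qed.

Lemma diff_mx_covers i v w : diff_mx i v w != 0 ->
  [/\ e w = mdegZ (lcm_deg (deg w)), e v = mdegZ (lcm_deg (deg v)) & covers (deg w) (deg v)].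
Proof.
by move=> /diff_mx_cov[l [a [ew ev la]]]; rewrite (deg_of ew) (deg_of ev).
Qed.

Lemma deg_neq_bot i (v : 'I_(r i.+1)) : deg v != \bot%O.
Proof. by have [w /diff_mx_covers[_ _ /covers_neq_bot]] := diff_mx_neq0 v. Qed.

(** The differential with all variables set to 1: by homogeneity each nonzero entry is a scalar
    times this one monomial. *)
Definition strand_mx i : 'M[k]_(r i.+1, r i) :=
  \matrix_(v, w) (diff_mx i v w)@_(lcm_deg (deg v) - lcm_deg (deg w)).

Lemma strand_mx_covers i v w : strand_mx i v w != 0 -> covers (deg w) (deg v).
Proof.
rewrite mxE => nz; have /diff_mx_covers[] // : diff_mx i v w != 0.
by apply: contraNneq nz => ->; rewrite mcoeff0.
Qed.

Lemma monomial_mx_strand_mx i : monomial_mx (@lcm_deg k n N) deg strand_mx i = diff_mx i.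
Proof.
apply/matrixP=> v w; rewrite monomial_mxE mxE.
have [->|nz] := eqVneq (diff_mx i v w) 0; first by rewrite mcoeff0 scale0r.
have [ew ev /covers_lt/ltW wv] := diff_mx_covers nz; rewrite lcm_deg_le in wv.
apply/esym/poly_comp_monomial; rewrite mdegZB // -ew -ev; exact: diff_mx_homog.
Qed.

Lemma lattice_linear_strands : strands deg strand_mx.
Proof.
have [w0 [w0P ew0 kerP]] := first_basis.
have d0 w : @deg 0 w = \bot%O.
  by rewrite (w0P w); apply: deg_of; rewrite ew0 lcm_deg_bot mdegZ0.
apply: (@strands_of_exact _ _ _ _ (@lcm_deg k n N)) => //.
- exact: strand_mx_covers.
- by move=> i; rewrite !monomial_mx_strand_mx diff_mx_complex.
- by move=> i u; rewrite !monomial_mx_strand_mx; apply: diff_mx_exact.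
- move=> a a0 u; rewrite monomial_mx_strand_mx; apply/kerP.
  rewrite mxE d0 lcm_deg_bot -mul_mpolyC idealMr //.
  have -> : (lcm_deg a - 0 = lcm_deg a)%MM by apply/mnmP=> i; rewrite !mnmE subn0.
  exact: lcm_deg_in.
- by rewrite -[LHS]card_ord; apply/eqP/fintype1P; exists w0.
exact: deg_neq_bot.
Qed.

Let HS := lattice_linear_strands.
Let Psi i (x : 'rV[R]_(r i)) : Fdeg N i := Feta_iso (@lcm_deg k n N) deg strand_mx x.

Let Psi_inj i : injective (@Psi i).
Proof. exact: Feta_iso_inj HS i. Qed.

Let Psi_surj i (z : Fdeg N i) : exists x, Psi x = z.
Proof. exact: Feta_iso_surj HS i z. Qed.

Let Psi_diff i (x : 'rV[R]_(r i.+1)) : mg_diff (Fdeg N) i (Psi x) = Psi (x *m diff_mx i).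
Proof.
by rewrite -monomial_mx_strand_mx; apply: (Feta_iso_diff (lcm_deg_bot N) strand_mx_covers HS).
Qed.

Lemma Fdeg_complex i (x : Fdeg N i.+2) : mg_diff (Fdeg N) i (mg_diff (Fdeg N) i.+1 x) = 0.
Proof.
have [y <-] := Psi_surj x; rewrite !Psi_diff -mulmxA diff_mx_complex mulmx0.
exact: Feta_iso0.
Qed.

Lemma Fdeg_exact i (x : Fdeg N i.+1) : mg_diff (Fdeg N) i x = 0 ->
  exists y : Fdeg N i.+2, mg_diff (Fdeg N) i.+1 y = x.
Proof.
have [y <-] := Psi_surj x; rewrite Psi_diff => y0.
have [|z zy] := @diff_mx_exact _ y; first by apply: Psi_inj; rewrite y0; apply/esym/Feta_iso0.
by exists (Psi z); rewrite Psi_diff zy.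
Qed.

Lemma Fdeg_coker : coker_is_quot (Fdeg N) N.
Proof.
have [eps [epsD epsZ eps_surj eps_ker eps_deg]] := mfr_coker HF.
have [B B1] := hmap0_mx_surj HS.
pose inv (z : Fdeg N 0) : 'rV[R]_(r 0) := (z : 'rV[R]_(_)) *m map_mx (@mpolyC n k) B.
have invK z : Psi (inv z) = z.
  by rewrite /Psi /= /inv -mulmxA -map_mxM B1 map_mx1 mulmx1.
have PsiK x : inv (Psi x) = x by apply: Psi_inj; rewrite invK.
have [w0 [w0P ew0 _]] := first_basis.
(* The augmentation of F is carried through the inverse isomorphism in position 0. It respects
   degrees because that inverse has scalar entries and the only generator on either side has degree
   0. *)
exists (fun z => eps (lincomb (inv z))); split.
- by move=> x y; rewrite /inv mulmxDl lincombD epsD.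
- by move=> p x; rewrite /inv -scalemxAl lincombZ epsZ.
- move=> q; have [y <-] := eps_surj q; have [x <-] := lincomb_surj y.
  by exists (Psi x); rewrite PsiK.
- move=> z; split=> [/eps_ker[t tz]|[y <-]].
    have [t' tt'] := lincomb_surj t; exists (Psi t'); rewrite Psi_diff -[RHS]invK; congr (Psi _).
    by apply: lincomb_inj; rewrite -diff_lincomb tt'.
  have [y' <-] := Psi_surj y; rewrite Psi_diff PsiK; apply/eps_ker.
  by exists (lincomb y'); rewrite diff_lincomb.
move=> d z zd; apply: eps_deg; apply: comp_combination (mfr_free HF 0) (mh 0) _ => w.
rewrite (w0P w) ew0 subr0 mxE; apply: poly_comp_sum => c.
by rewrite mxE -[d]addr0; apply: poly_compM (zd c) (@poly_compC _ _ _).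
Qed.

End LatticeLinear.

(** * Standard bases of F(eta) *)

Section MaxIdeal.
Variables (k : fieldType) (n : nat).
Local Notation R := {mpoly k[n]}.

Lemma in_maxideal0 (M : lmodType R) : in_maxideal (0 : M).
Proof. by exists (fun=> 0); rewrite big1 // => i _; rewrite scaler0. Qed.

Lemma in_maxidealD (M : lmodType R) (x y : M) :
  in_maxideal x -> in_maxideal y -> in_maxideal (x + y).
Proof.
move=> [x' ->] [y' ->]; exists (fun i => x' i + y' i).
by rewrite -big_split; apply: eq_bigr => i _; rewrite scalerDr.
Qed.

Lemma in_maxidealX (M : lmodType R) m (x : M) : m != 0%MM -> in_maxideal ('X_[m] *: x).
Proof.
move=> m0; have [i mi] : exists i, m i != 0%N.
  apply/existsP; apply: contraNT m0; rewrite negb_exists => /forallP h.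
  by apply/eqP/mnmP=> i; have := h i; rewrite negbK mnm0E => /eqP.
have Um : (U_(i) <= m)%MM.
  by apply/mnm_lepP => j; rewrite mnm1E; case: eqP => // <-; rewrite lt0n.
exists (fun j => if j == i then 'X_[m - U_(i)] *: x else 0).
rewrite (bigD1 i) //= eqxx big1 ?addr0 => [|j /negPf->]; last by rewrite scaler0.
by rewrite scalerA -mpolyXD addmC submK.
Qed.

Lemma in_maxideal_dsum (I : finType) (V : I -> lmodType R) (u : dsum V) :
  (forall i, in_maxideal (u i)) -> in_maxideal u.
Proof.
move=> /fin_all_exists[y yE]; exists (fun j => [ffun i => y i j] : dsum V).
apply/ffunP=> i; rewrite yE.
rewrite (big_morph (fun w : dsum V => w i) (id1 := 0) (op1 := +%R)) //; last by rewrite ffunE.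
  by apply: eq_bigr => j _; rewrite dsumZE ffunE.
by move=> v w; rewrite dsumDE.
Qed.

End MaxIdeal.

Section StandardBasis.
Variables (k : fieldType) (n : nat) (disp : Order.disp_t).
Variables (P : finBPOrderType disp) (eta : P -> 'X_{1..n}).
Local Notation R := {mpoly k[n]}.
Local Notation P' := {l : P | l != \bot%O}.

Hypothesis eta_le : forall x y, (x <= y)%O = (eta x <= eta y)%MM.
Hypothesis eta_bot : eta \bot%O = 0%MM.

Definition std_index j : finType := {l : P' & 'I_(\dim {:C k j (val l)})}.

Definition std_elt j (x : std_index j) : Feta_sum k n P j :=
  [ffun l : P' => \row_c (Tagged (fun l : P' => 'I_(\dim {:C k j (val l)})) c == x)%:R].

Definition std_rank i := if i is j.+1 then #|std_index j| else \dim {:C0 k P}.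

Definition std_basis i : 'I_(std_rank i) -> Feta k eta i :=
  match i return 'I_(std_rank i) -> Feta k eta i with
  | 0 => fun c => (delta_mx 0 c : bchange n (C0 k P))
  | j.+1 => fun t => std_elt (enum_val t)
  end.

Definition std_deg i : 'I_(std_rank i) -> 'rV[int]_n :=
  match i return 'I_(std_rank i) -> 'rV[int]_n with
  | 0 => fun=> 0
  | j.+1 => fun t => mdegZ (eta (val (tag (enum_val t))))
  end.

Definition std_coord i : Feta k eta i -> 'rV[R]_(std_rank i) :=
  match i return Feta k eta i -> 'rV[R]_(std_rank i) with
  | 0 => fun u => (u : 'rV[R]_(_))
  | j.+1 => fun u => \row_t (u : Feta_sum k n P j) (tag (enum_val t)) 0 (tagged (enum_val t))
  end.

Lemma std_elt_neq j (x : std_index j) l : l != tag x -> std_elt x l = 0.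
Proof.
move=> lx; apply/rowP=> c; rewrite ffunE !mxE; case: eqP => // e.
by rewrite -e eqxx in lx.
Qed.

Lemma dsum_sumE (I : finType) (V : I -> lmodType R) (J : finType) (f : J -> dsum V) i :
  (\sum_j f j) i = \sum_j f j i.
Proof.
rewrite (big_morph (fun w : dsum V => w i) (id1 := 0) (op1 := +%R)) //; last by rewrite ffunE.
by move=> v w; rewrite dsumDE.
Qed.

Lemma std_combE j (c : 'rV[R]_#|std_index j|) l d :
  (\sum_t c 0 t *: std_elt (enum_val t) : Feta_sum k n P j) l 0 d
    = c 0 (enum_rank (Tagged (fun l : P' => 'I_(\dim {:C k j (val l)})) d)).
Proof.
rewrite dsum_sumE summxE (bigD1 (enum_rank (Tagged _ d))) //= big1 => [|t tx].
  by rewrite dsumZE ffunE !mxE enum_rankK eqxx mulr1 addr0.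
rewrite dsumZE ffunE !mxE; case: eqP => [e|_]; last by rewrite mulr0.
by rewrite e enum_valK eqxx in tx.
Qed.

Lemma std_coordE i (u : Feta k eta i) : u = \sum_t std_coord u 0 t *: std_basis t.
Proof.
case: i u => [|j] u /=; first exact: row_sum_delta.
apply/ffunP=> l; apply/rowP=> d; rewrite std_combE mxE enum_rankK.
by [].
Qed.

Lemma std_coord_sum i (c : 'rV[R]_(std_rank i)) :
  std_coord (\sum_t c 0 t *: std_basis t) = c.
Proof.
case: i c => [|j] c /=; first by rewrite -row_sum_delta.
apply/rowP=> t; rewrite mxE std_combE; congr (c 0 _).
by rewrite -[RHS]enum_valK; congr enum_rank; case: (enum_val t).
Qed.

Lemma std_basisP i : is_basis (@std_basis i).
Proof.
move=> u; exists (std_coord u); split; first exact: std_coordE.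
by move=> c ->; rewrite std_coord_sum.
Qed.

Lemma std_comp i d (u : Feta k eta i) :
  mg_comp d u <-> forall t, poly_comp (d - std_deg t) (std_coord u 0 t).
Proof.
case: i u => [|j] u /=; split=> h.
- by move=> t; rewrite subr0; apply: h.
- by move=> c; have := h c; rewrite subr0.
- by move=> t; rewrite mxE; apply: h.
move=> l c; have := h (enum_rank (Tagged (fun l : P' => 'I_(\dim {:C k j (val l)})) c)).
by rewrite mxE enum_rankK.
Qed.

Lemma Feta_free i : mgfree (Feta k eta i).
Proof.
exists (std_rank i), (@std_basis i), (@std_deg i); split; first exact: std_basisP.
move=> d u; split=> [/std_comp h|[c -> h]].
  by exists (std_coord u); first exact: std_coordE.
by apply/std_comp; rewrite std_coord_sum.
Qed.

Lemma std_mhbasis i : mhbasis (@std_basis i) (@std_deg i).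
Proof.
split=> [|t]; first exact: std_basisP.
have -> : std_basis t = \sum_t' (delta_mx 0 t : 'rV[R]_(std_rank i)) 0 t' *: std_basis t'.
  rewrite (bigD1 t) //= big1 ?addr0 => [|t' /negPf t't]; first by rewrite mxE !eqxx scale1r.
  by rewrite mxE t't andbF scale0r.
apply/std_comp => t'; rewrite std_coord_sum mxE eqxx /=.
case: eqP => [->|_]; last exact: poly_comp0.
by rewrite subrr -mpolyC1; apply: poly_compC.
Qed.

Lemma bchange_map_comp (V W : vectType k) m (f : 'Hom(V, W)) d (u : bchange n V) :
  (forall c, poly_comp d (u 0 c)) -> forall c, poly_comp (mdegZ m + d) (bchange_map m f u 0 c).
Proof.
move=> h c; rewrite /bchange_map mxE; apply: poly_compM; first exact: poly_compX.
rewrite mxE; apply: poly_comp_sum => t; rewrite mxE -[d]addr0.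
exact: poly_compM (h t) (@poly_compC _ _ _).
Qed.

Lemma Feta_homog i d (u : Feta k eta i.+1) : mg_comp d u -> mg_comp d (mg_diff (Feta k eta) i u).
Proof.
case: i u => [|j] u /= h.
  move=> c; rewrite summxE; apply: poly_comp_sum => l.
  by have := @bchange_map_comp _ _ (eta (val l)) (phi1 k (val l)) _ _ (h l) c; rewrite addrC subrK.
move=> l c; rewrite ffunE summxE big_mkcond; apply: poly_comp_sum => a.
case: ifP => [/covers_lt/ltW la|_]; last exact: poly_comp0.
have := @bchange_map_comp _ _ (eta (val a) - eta (val l))%MM (phi k j (val a) (val l)) _ _ (h a) c.
by rewrite mdegZB -?eta_le // addrC addrA subrK.
Qed.

(** [eta] reflects the order, so a zero exponent in the differential would give [l <= \bot] in
    position 0, or [a <= l] for an [l] covered by [a]. *)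
Lemma Feta_minimal i (u : Feta k eta i.+1) : in_maxideal (mg_diff (Feta k eta) i u).
Proof.
case: i u => [|j] u /=.
  apply: big_ind => [|x y|l _]; [exact: in_maxideal0 | exact: in_maxidealD |].
  apply: in_maxidealX; apply: contraNneq (valP l) => l0.
  by rewrite -lex0 eta_le l0 eta_bot lepm_refl.
apply: in_maxideal_dsum => l; rewrite ffunE.
apply: big_ind => [|x y|a la]; [exact: in_maxideal0 | exact: in_maxidealD |].
apply: in_maxidealX; apply: contraTneq (covers_lt la) => /mnmP e.
suff al : (val a <= val l)%O by apply/negP=> /lt_geF; rewrite al.
by rewrite eta_le; apply/mnm_lepP=> i; have := e i; rewrite mnmBE mnm0E => /eqP; rewrite subn_eq0.
Qed.

Lemma bchange_map0 (V W : vectType k) m (u : bchange n V) :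
  bchange_map m (0 : 'Hom(V, W)) u = 0.
Proof. by rewrite /bchange_map linear0 map_mx0 mulmx0 scaler0. Qed.

(** The sums defining the differential run over covers only, except in the lowest position, where
    [phi1] is zero off the atoms. *)
Lemma std_coord_diff_covers i (t : 'I_(std_rank i.+1)) w :
    std_coord (mg_diff (Feta k eta) i (std_basis t)) 0 w != 0 ->
  exists l a : P, [/\ std_deg w = mdegZ (eta l), std_deg t = mdegZ (eta a) & covers l a].
Proof.
case: i t w => [|j] t w /= nz.
  exists \bot%O, (val (tag (enum_val t))); split=> //; first by rewrite eta_bot mdegZ0.
  apply: contraNT nz => ct; apply/eqP; rewrite /Feta_diff1 big1 ?mxE // => l _.
  have [->|lt] := eqVneq l (tag (enum_val t)).
    by rewrite /phi1 (negPf ct) bchange_map0.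
  by rewrite std_elt_neq // linear0.
exists (val (tag (enum_val w))), (val (tag (enum_val t))); split=> //.
apply: contraNT nz => ct; apply/eqP; rewrite mxE ffunE big1 ?mxE // => a ca.
rewrite std_elt_neq ?linear0 //.
by apply: contraNneq ct => <-.
Qed.

End StandardBasis.

Theorem theorem5p3 (k : fieldType) (n : nat) (N : idealr {mpoly k[n]})
    (hN : monomial_ideal N) :
  lattice_linear N <-> minimal_free_resolution N (Fdeg N).
Proof.
have eta_le (x y : lcm_lattice N) : (x <= y)%O = (lcm_deg x <= lcm_deg y)%MM := lcm_deg_le x y.
split=> [[F HF [r [b [e [mh cov]]]]]|HF].
  split.
  - exact: Feta_free.
  - exact: Feta_homog.
  - exact: Fdeg_complex hN HF mh cov.
  - exact: Fdeg_exact hN HF mh cov.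
  - exact: Fdeg_coker hN HF mh cov.
  exact: Feta_minimal eta_le (lcm_deg_bot N).
exists (Fdeg N) => //.
exists (std_rank k (lcm_lattice N)), (@std_basis k n _ _ (@lcm_deg k n N)),
  (std_deg (@lcm_deg k n N)).
split=> [i|i v c dE w cw]; first exact: std_mhbasis.
have := @std_coord_diff_covers _ _ _ _ (@lcm_deg k n N) (lcm_deg_bot N) i v w.
by rewrite dE std_coord_sum; apply.
Qed.
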